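(* Any $2n$-dimensional simply connected solvable Lie group $G$ equipped with a left invariant complex structure $J$ admits a nowhere vanishing closed (smooth, complex-valued, not necessarily left invariant) $(n,0)$-form $\tau$. In particular, the canonical bundle of $(G,J)$ is trivial.
   Context: A left invariant complex structure on $G$ is a complex structure for which left translations are holomorphic. The canonical bundle of a complex manifold $M$ of complex dimension $n$ is $K_M=\bigwedge^n\mathcal{T}^*_M$ with $\mathcal{T}^*_M$ the holomorphic cotangent bundle; ''trivial'' means holomorphically trivial, i.e. $M$ has a nowhere vanishing holomorphic (equivalently, closed) $(n,0)$-form. *)

(* Defs.v *)
From HB Require Import structures.
From mathcomp Require Import all_boot all_order all_algebra.
From mathcomp Require Import complex.
From mathcomp Require Import all_classical all_reals all_analysis.

Set Implicit Arguments.
Unset Strict Implicit.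
Unset Printing Implicit Defensive.

Import Order.TTheory GRing.Theory Num.Theory.
Import numFieldNormedType.Exports.

Local Open Scope classical_set_scope.
Local Open Scope ring_scope.

HB.mixin Record isTopologicalGroup G of Group G & Topological G := {
  mulg_continuous : continuous (fun z : G * G => (z.1 * z.2)%g);
  invg_continuous : continuous (fun x : G => (x^-1)%g)
}.

#[short(type="topologicalGroupType")]
HB.structure Definition TopologicalGroup :=
  {G of Group G & Topological G & isTopologicalGroup G}.

Section SolvableGroup.
Variable G : groupType.

Definition subgroup (K : set G) : Prop :=
  K 1%g /\ forall x y, K x -> K y -> K (x * y^-1)%g.

Definition generated (S : set G) : set G :=
  [set x | forall K, subgroup K -> S `<=` K -> K x].

Definition derived_subgroup (K : set G) : set G :=
  generated [set z | exists x y, [/\ K x, K y & z = [~ x, y]%g]].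

Definition solvable_group : Prop :=
  exists k : nat, iter k derived_subgroup [set: G] = [set 1%g].

End SolvableGroup.

Section SimplyConnected.
Variables (R : realType) (M : topologicalType).

Definition path_connected : Prop :=
  forall p q : M, exists c : R -> M,
    [/\ {within `[0, 1], continuous c}, c 0 = p & c 1 = q].

(* [h (t, s)]: [t] is the loop parameter, [s] the homotopy parameter; the
   homotopy is relative to the base point. *)
Definition null_homotopic (c : R -> M) : Prop :=
  exists h : R * R -> M,
    [/\ {within `[0, 1] `*` `[0, 1], continuous h},
        forall t, t \in `[0, 1] -> h (t, 0) = c t /\ h (t, 1) = c 0
      & forall s, s \in `[0, 1] -> h (0, s) = c 0 /\ h (1, s) = c 0].

Definition simply_connected : Prop :=
  path_connected /\
  forall c : R -> M,
    {within `[0, 1], continuous c} -> c 0 = c 1 -> null_homotopic c.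

End SimplyConnected.

Section Smooth.
Variables (R : realType) (V W : normedModType R).

(* The domain [U] is always an open set of a finite-dimensional space, where
   this is the usual notion: all iterated directional (equivalently, partial)
   derivatives up to order [k] exist and are continuous. *)
Fixpoint Ck (k : nat) (U : set V) (f : V -> W) : Prop :=
  (forall x, U x -> {for x, continuous f}) /\
  if k is k'.+1 then
    forall v, (forall x, U x -> derivable f x v) /\ Ck k' U ('D_v f)
  else True.

Definition smooth_on (U : set V) (f : V -> W) : Prop := forall k, Ck k U f.

End Smooth.

(* C^n is R^(n + n), with [row_mx x y] standing for x + iy; [mulJ] is the
   multiplication by i. *)
Definition mulJ (R : realType) (n : nat) (v : 'rV[R]_(n + n)) : 'rV[R]_(n + n) :=
  row_mx (- rsubmx v) (lsubmx v).

Definition holomorphic_on (R : realType) (n : nat) (U : set 'rV[R]_(n + n))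
    (f : 'rV[R]_(n + n) -> 'rV[R]_(n + n)) : Prop :=
  smooth_on U f /\
  forall x v, U x -> 'D_(mulJ v) f x = mulJ ('D_v f x).

Section ComplexValued.
Variables (R : realType) (V : normedModType R).
Implicit Type f : V -> R[i].

Definition realpart f : V -> R^o := fun x => complex.Re (f x).
Definition imagpart f : V -> R^o := fun x => complex.Im (f x).

Definition csmooth_on (U : set V) f : Prop :=
  smooth_on U (realpart f) /\ smooth_on U (imagpart f).

Definition cderive (v : V) f (x : V) : R[i] :=
  Complex ('D_v (realpart f) x) ('D_v (imagpart f) x).

End ComplexValued.

Definition cholomorphic_on (R : realType) (n : nat) (U : set 'rV[R]_(n + n))
    (f : 'rV[R]_(n + n) -> R[i]) : Prop :=
  csmooth_on U f /\
  forall x v, U x -> cderive (mulJ v) f x = 'i%C * cderive v f x.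

(* Only the restrictions of [chart_map] to [chart_dom] and of [chart_inv] to
   the image of [chart_dom] are meaningful. *)
Record chart (R : realType) (M : topologicalType) (m : nat) := Chart {
  chart_dom : set M;
  chart_map :> M -> 'rV[R]_m;
  chart_inv : 'rV[R]_m -> M;
  chart_open_dom : open chart_dom;
  chart_open_cod : open (chart_map @` chart_dom);
  chart_mapK : forall p, chart_dom p -> chart_inv (chart_map p) = p;
  chart_map_continuous : {within chart_dom, continuous chart_map};
  chart_inv_continuous :
    {within chart_map @` chart_dom, continuous chart_inv}
}.

Definition chart_cod (R : realType) (M : topologicalType) (m : nat)
  (phi : chart R M m) : set 'rV[R]_m := phi @` chart_dom phi.

Section Manifold.
Variables (R : realType) (M : topologicalType) (m : nat).
Implicit Types (phi psi : chart R M m) (A : set (chart R M m)).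

Definition overlap phi psi : set 'rV[R]_m :=
  phi @` (chart_dom phi `&` chart_dom psi).

Definition transition phi psi : 'rV[R]_m -> 'rV[R]_m :=
  fun x => psi (chart_inv phi x).

Definition covering A : Prop :=
  forall p, exists2 phi, A phi & chart_dom phi p.

Definition smooth_atlas A : Prop :=
  covering A /\
  forall phi psi, A phi -> A psi ->
    smooth_on (overlap phi psi) (transition phi psi).

(* The maximal smooth atlas generated by [A]. *)
Definition smooth_charts A : set (chart R M m) :=
  [set phi | forall psi, A psi ->
     smooth_on (overlap phi psi) (transition phi psi) /\
     smooth_on (overlap psi phi) (transition psi phi)].

End Manifold.

Record lie_group (R : realType) (m : nat) (G : topologicalGroupType)
    (A : set (chart R G m)) : Prop := LieGroup {
  lie_hausdorff : hausdorff_space G;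
  lie_second_countable : @second_countable G;
  lie_atlas : smooth_atlas A;
  lie_mul_smooth : forall phi1 phi2 psi, A phi1 -> A phi2 -> A psi ->
    smooth_on
      ((fun z : G * G => (phi1 z.1, phi2 z.2)) @`
        [set z | [/\ chart_dom phi1 z.1, chart_dom phi2 z.2
                   & chart_dom psi (z.1 * z.2)%g]])
      (fun z : 'rV[R]_m * 'rV[R]_m =>
        psi (chart_inv phi1 z.1 * chart_inv phi2 z.2)%g);
  lie_inv_smooth : forall phi psi, A phi -> A psi ->
    smooth_on
      (phi @` [set p | chart_dom phi p /\ chart_dom psi (p^-1)%g])
      (fun x => psi ((chart_inv phi x)^-1)%g)
}.

(* A complex structure on the smooth manifold [(M, A)], given by an atlas [H]
   of holomorphic charts that are smooth for [A]. The endomorphism J of the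
   tangent bundle is [mulJ] in every chart of [H]. *)
Record complex_structure (R : realType) (M : topologicalType) (n : nat)
    (A H : set (chart R M (n + n))) : Prop := ComplexStructure {
  cplx_smooth : H `<=` smooth_charts A;
  cplx_covering : covering H;
  cplx_transition : forall phi psi, H phi -> H psi ->
    holomorphic_on (overlap phi psi) (transition phi psi)
}.

Definition left_invariant (R : realType) (G : topologicalGroupType) (n : nat)
    (H : set (chart R G (n + n))) : Prop :=
  forall (g : G) phi psi, H phi -> H psi ->
    holomorphic_on
      (phi @` [set p | chart_dom phi p /\ chart_dom psi (g * p)%g])
      (fun x => psi (g * chart_inv phi x)%g).

Definition upd (T : Type) (k : nat) (v : 'I_k -> T) (i : 'I_k) (a : T) :
  'I_k -> T := fun j => if j == i then a else v j.

Section Forms.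
Variables (R : realType) (M : topologicalType) (m : nat).

Definition alternating_multilinear (k : nat)
    (w : ('I_k -> 'rV[R]_m) -> R[i]) : Prop :=
  (forall v i (c : R) a b,
     w (upd v i (c *: a + b)) = c%:C%C * w (upd v i a) + w (upd v i b)) /\
  (forall v i j, i != j -> v i = v j -> w v = 0).

(* A k-form is given by its expressions in the charts: [tau phi x v] is the
   value at the point of coordinates [x] on the tangent vectors whose
   components in the chart [phi] are [v 0, ..., v (k - 1)]. *)
Definition form_data (k : nat) : Type :=
  chart R M m -> 'rV[R]_m -> ('I_k -> 'rV[R]_m) -> R[i].

Record differential_form (A : set (chart R M m)) (k : nat)
    (tau : form_data k) : Prop := DifferentialForm {
  form_multilinear : forall phi x, smooth_charts A phi -> chart_cod phi x ->
    alternating_multilinear (tau phi x);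
  form_smooth : forall phi v, smooth_charts A phi ->
    csmooth_on (chart_cod phi) (fun x => tau phi x v);
  form_compatible : forall phi psi p v,
    smooth_charts A phi -> smooth_charts A psi ->
    chart_dom phi p -> chart_dom psi p ->
    tau phi (phi p) v =
    tau psi (psi p) (fun j => 'D_(v j) (transition phi psi) (phi p))
}.

Definition exterior_derivative (k : nat)
    (w : 'rV[R]_m -> ('I_k -> 'rV[R]_m) -> R[i])
    (x : 'rV[R]_m) (v : 'I_k.+1 -> 'rV[R]_m) : R[i] :=
  \sum_(i < k.+1)
    (-1) ^+ i * cderive (v i) (fun y => w y (fun j => v (lift i j))) x.

Definition closed_form (A : set (chart R M m)) (k : nat)
    (tau : form_data k) : Prop :=
  forall phi x v, smooth_charts A phi -> chart_cod phi x ->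
    exterior_derivative (tau phi) x v = 0.

Definition nowhere_vanishing (A : set (chart R M m)) (k : nat)
    (tau : form_data k) : Prop :=
  forall phi x, smooth_charts A phi -> chart_cod phi x ->
    exists v, tau phi x v != 0.

End Forms.

Section HolomorphicForms.
Variables (R : realType) (M : topologicalType) (n : nat).
Implicit Types A H : set (chart R M (n + n)).

(* Forms of type (k, 0): complex multilinear for J. *)
Definition type_k0 H (k : nat) (tau : form_data R M (n + n) k) : Prop :=
  forall phi x v i, H phi -> chart_cod phi x ->
    tau phi x (upd v i (mulJ (v i))) = 'i%C * tau phi x v.

(* For a form of type (k, 0), the functions below are the constant-coefficient
   combinations of its coefficients in the basis of the dz_I. *)
Definition holomorphic_form H (k : nat) (tau : form_data R M (n + n) k) : Prop :=
  forall phi v, H phi ->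
    cholomorphic_on (chart_cod phi) (fun x => tau phi x v).

(* The holomorphic sections of the canonical bundle are the holomorphic
   (n, 0)-forms, and a holomorphic line bundle is trivial when it has a
   nowhere vanishing holomorphic section. *)
Definition canonical_bundle_trivial A H : Prop :=
  exists tau : form_data R M (n + n) n,
    [/\ differential_form A tau, type_k0 H tau, holomorphic_form H tau
      & nowhere_vanishing A tau].

End HolomorphicForms.

(* Main.v *)
(* Left translations are holomorphic, so right-invariant vector fields are
   infinitesimal automorphisms of the complex structure: in holomorphic charts
   their coefficients are holomorphic. The wedge of [n] complex combinations of
   them is thus a holomorphic section of the anticanonical bundle. In the left
   trivialization the right-invariant field of [Y] takes the value [Ad(p^-1) Y]
   at [p], so the section vanishes nowhere as soon as [Ad(p^-1)] maps the span
   of the chosen [Y]'s to a complement of the space of antiholomorphic vectors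
   of the Lie algebra, for every [p]. By Lie-Kolchin the adjoint group preserves
   a complete flag of the complexified Lie algebra, and the elements of an
   adapted basis that survive modulo the antiholomorphic vectors have this
   property. The dual section is the required form: it is [h dz_1 ... dz_n] with
   [h] holomorphic, hence closed.
   Connectedness enters through the fact that continuous functions with finitely
   many values are constant, a property that passes to derived subgroups. *)
Require Import Defs.
From HB Require Import structures.
From mathcomp Require Import all_boot all_order all_algebra.
From mathcomp Require Import complex.
From mathcomp Require Import all_classical all_reals all_analysis.
From mathcomp Require Import perm.

Set Implicit Arguments.
Unset Strict Implicit.
Unset Printing Implicit Defensive.

Import Order.TTheory GRing.Theory Num.Theory.
Import numFieldNormedType.Exports.

Local Open Scope classical_set_scope.
Local Open Scope ring_scope.

(** * Directional derivatives and C^k functions *)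

(** [Ck] speaks of directional derivatives only, so differentiability of C^1 maps and the symmetry
    of second derivatives are obtained from mean value estimates along lines. No exponential map and
    no Lie bracket occur. A holomorphic chart [psi0] at the unit stands for the exponential, its
    coordinate space for the Lie algebra, and Ad is the derivative of conjugation read in [psi0].
    Derived subgroups need not be closed; connectedness is therefore tested by functions on the
    whole of [G], and the subgroup carries no topology. The form needs an expression in every smooth
    chart, not only in the holomorphic ones. At each point it is pulled back from a chosen
    holomorphic chart; the choice has no regularity, and smoothness comes from independence of the
    choice. Closedness is proved in an arbitrary smooth chart: d of the pullback of h dz_1 ... dz_n
    splits into second derivatives of the chart change, which cancel by symmetry, and a pullback of
    the wedge of dh with dz_1 ... dz_n, which is zero because dh is a combination of the dz_k. *)

Class fin_dim (R : realType) (V : normedModType R) := FinDim {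
  fd_dim : nat;
  fd_basis : 'I_fd_dim -> V;
  fd_coord : 'I_fd_dim -> {linear V -> R^o};
  fd_coord_continuous : forall i, continuous (fd_coord i);
  fd_sum : forall v, v = \sum_i fd_coord i v *: fd_basis i
}.

Section ChainRule.
Variable R : realType.
Implicit Types V W Z : normedModType R.

(** The inner map needs a derivative along [v] only: restricted to the line through [x] it depends
    on one real variable, where derivability is differentiability. *)
Lemma is_derive_comp V W Z (g : V -> W) (f : W -> Z) x v :
  derivable g x v -> differentiable f (g x) ->
  is_derive x v (f \o g) ('D_('D_v g x) f (g x)).
Proof.
move=> dg df.
have dg1 : differentiable (fun h : R => g (h *: v + x)) 0.
  by apply/derivable1_diffP; exact: (derivable1P _ _ _).1.
have df' : differentiable f (g (0 *: v + x)) by rewrite scale0r add0r.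
have dc := differentiable_comp dg1 df'.
have E (Z' : normedModType R) (k : V -> Z') :
    'D_v k x = 'D_1 (fun h : R => k (h *: v + x)) 0.
  rewrite /derive; set g1 := fun h => h^-1 *: _; set g2 := fun h => h^-1 *: _.
  suff -> : g1 = g2 by [].
  by apply/funext => h; rewrite /g1 /g2 /= addr0 scale0r add0r [_%:A]mulr1.
apply: DeriveDef.
  by apply: (derivable1P _ _ _).2; apply/derivable1_diffP; exact: dc.
rewrite E deriveE; last exact: dc.
rewrite (@diff_comp _ _ _ _ (fun h : R => g (h *: v + x)) f) //=.
by rewrite -(deriveE _ dg1) -E scale0r add0r (deriveE _ df).
Qed.

Lemma derive_comp V W Z (g : V -> W) (f : W -> Z) x v :
  derivable g x v -> differentiable f (g x) ->
  'D_v (f \o g) x = 'D_('D_v g x) f (g x).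
Proof. by move=> dg df; have [] := is_derive_comp dg df. Qed.

Lemma is_derive_linear V W Z (L : {linear W -> Z}) (f : V -> W) x v :
  continuous L -> derivable f x v -> is_derive x v (L \o f) (L ('D_v f x)).
Proof.
move=> cL df.
have dL y : differentiable L y by exact: linear_differentiable.
have := is_derive_comp df (dL (f x)).
by rewrite deriveE // diff_lin.
Qed.

Lemma deriveZv V W (f : V -> W) x (c : R) v :
  differentiable f x -> 'D_(c *: v) f x = c *: 'D_v f x.
Proof. by move=> df; rewrite !deriveE // linearZ. Qed.

Lemma deriveDv V W (f : V -> W) x u v :
  differentiable f x -> 'D_(u + v) f x = 'D_u f x + 'D_v f x.
Proof. by move=> df; rewrite !deriveE // linearD. Qed.

Lemma derive_basis V W {fd : fin_dim V} (f : V -> W) x v :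
  differentiable f x ->
  'D_v f x = \sum_i fd_coord i v *: 'D_(fd_basis i) f x.
Proof.
move=> df; rewrite deriveE // {1}(fd_sum v) linear_sum.
by apply: eq_bigr => i _; rewrite linearZ deriveE.
Qed.

End ChainRule.

(** * Closure properties of C^k functions *)

Section CkTheory.
Variable R : realType.
Implicit Types V W Z : normedModType R.

Lemma Ck_continuous V W k (U : set V) (f : V -> W) :
  Ck k U f -> forall x, U x -> {for x, continuous f}.
Proof. by case: k => [|k] []. Qed.

Lemma near_eq_continuous (T U : topologicalType) (f g : T -> U) (x : T) :
  {near x, f =1 g} -> {for x, continuous f} -> {for x, continuous g}.
Proof.
move=> fg; rewrite /prop_for /= /continuous_at (nbhs_singleton fg).
by apply: cvg_trans; apply: near_eq_cvg; apply: filterS fg => y ->.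
Qed.

Lemma CkS V W k (U : set V) (f : V -> W) : Ck k.+1 U f -> Ck k U f.
Proof.
elim: k f => [|k IH] f [cf df]; first by split.
by split => // v; have [dv Dv] := df v; split => //; exact: IH.
Qed.

Lemma Ck_subset V W k (U U' : set V) (f : V -> W) :
  U' `<=` U -> Ck k U f -> Ck k U' f.
Proof.
move=> UU'; elim: k f => [|k IH] f [cf df]; split => //=; try by move=> x /UU'/cf.
by move=> v; have [dv Dv] := df v; split; [move=> x /UU'/dv|exact: IH].
Qed.

(** [Ck] differentiates total functions and uses [U] only to say where, so it is a conjunction of
    conditions at single points. *)
Lemma Ck_pointwise V W k (U : set V) (f : V -> W) :
  (forall x, U x -> Ck k [set x] f) -> Ck k U f.
Proof.
elim: k f => [|k IH] f H; split => //.
- by move=> x Ux; have /Ck_continuous := H x Ux; apply.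
- by move=> x Ux; have /Ck_continuous := H x Ux; apply.
- move=> v; split; first by move=> x Ux; have [_ /(_ v)[+ _]] := H x Ux; apply.
  by apply: IH => x Ux; have [_ /(_ v)[]] := H x Ux.
Qed.

Lemma Ck_ext V W k (U : set V) (f g : V -> W) : open U ->
  (forall x, U x -> f x = g x) -> Ck k U f -> Ck k U g.
Proof.
move=> oU.
have nfg Z (h l : V -> Z) : (forall x, U x -> h x = l x) ->
    forall x, U x -> {near x, h =1 l}.
  move=> hl x Ux; move: (open_nbhs_nbhs (conj oU Ux)).
  by apply: filterS => y /hl.
elim: k f g => [|k IH] f g fg [cf df].
  by split => // x Ux; apply: (near_eq_continuous (nfg _ f g fg x Ux)); exact: cf.
split.
  by move=> x Ux; apply: (near_eq_continuous (nfg _ f g fg x Ux)); exact: cf.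
move=> v; have [dv Dv] := df v; split.
  by move=> x Ux; apply: near_eq_derivable (dv _ Ux); exact: (nfg _ f g).
by apply: IH Dv => x Ux; apply: near_eq_derive; exact: (nfg _ f g).
Qed.

Lemma Ck_cst V W k (U : set V) (a : W) : Ck k U (cst a).
Proof.
elim: k a => [|k IH] a; split => //; try by move=> x _; exact: cvg_cst.
move=> v; split => [x _|]; first exact: derivable_cst.
have -> : 'D_v (cst a) = cst (0 : W) :> (V -> W) by apply/funext => x; exact: derive_cst.
exact: IH.
Qed.

Lemma Ck_linear V W k (U : set V) (L : {linear V -> W}) :
  continuous L -> Ck k U L.
Proof.
move=> cL; case: k => [|k]; split => //; try by move=> x _; exact: cL.
move=> v; split => [x _|].
  exact/diff_derivable/linear_differentiable.
have -> : 'D_v L = cst (L v).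
  apply/funext => x; rewrite deriveE ?diff_lin //; exact: linear_differentiable.
exact: Ck_cst.
Qed.

Lemma Ck_add V W k (U : set V) (f g : V -> W) : open U ->
  Ck k U f -> Ck k U g -> Ck k U (f \+ g).
Proof.
move=> oU; elim: k f g => [|k IH] f g [cf df] [cg dg]; split => //;
  try by move=> x Ux; apply: (@continuousD _ _ _ f g); [exact: cf|exact: cg].
move=> v; have [fv Fv] := df v; have [gv Gv] := dg v; split.
  by move=> x Ux; apply: derivableD; [exact: fv|exact: gv].
apply: (Ck_ext oU _ (IH _ _ Fv Gv)) => x Ux.
by have /esym := deriveD (fv _ Ux) (gv _ Ux).
Qed.

Lemma Ck_sum V W k (U : set V) n (f : 'I_n -> V -> W) : open U ->
  (forall i, Ck k U (f i)) -> Ck k U (fun x => \sum_i f i x).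
Proof.
move=> oU; elim: n f => [|n IH] f H.
  apply: Ck_ext (@Ck_cst V W k U 0) => // x _; by rewrite big_ord0.
have := Ck_add oU (IH (fun i => f (widen_ord (leqnSn n) i)) (fun i => H _)) (H ord_max).
by apply: Ck_ext => // x _; rewrite big_ord_recr.
Qed.

Lemma Ck_mul V k (U : set V) (f g : V -> R^o) : open U ->
  Ck k U f -> Ck k U g -> Ck k U (fun x => f x * g x).
Proof.
move=> oU; elim: k f g => [|k IH] f g.
  by move=> [cf _] [cg _]; split => // x Ux; apply: (@continuousM R V f g); [exact: cf|exact: cg].
move=> Cf Cg; have [cf df] := Cf; have [cg dg] := Cg; split.
  by move=> x Ux; apply: (@continuousM R V f g); [exact: cf|exact: cg].
move=> v; have [fv Fv] := df v; have [gv Gv] := dg v; split.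
  by move=> x Ux; apply: (@derivableM R V f g); [exact: fv|exact: gv].
have H := Ck_add oU (IH _ _ (CkS Cf) Gv) (IH _ _ (CkS Cg) Fv).
apply: (Ck_ext oU _ H) => x Ux /=.
by have -> := @deriveM R V f g x v (fv _ Ux) (gv _ Ux).
Qed.

Lemma Ck_inv V k (U : set V) (f : V -> R^o) : open U ->
  (forall x, U x -> f x != 0) -> Ck k U f -> Ck k U (fun x => (f x)^-1).
Proof.
move=> oU f0; elim: k => [|k IH].
  by move=> [cf _]; split => // x Ux; apply: cvgV; [exact: f0|exact: cf].
move=> Cf; have [cf df] := Cf; split.
  by move=> x Ux; apply: cvgV; [exact: f0|exact: cf].
move=> v; have [fv Fv] := df v; split.
  by move=> x Ux; apply: derivableV; [exact: f0|exact: fv].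
have H := IH (CkS Cf).
have {}H := Ck_mul oU (@Ck_cst V R^o k U (-1)) (Ck_mul oU (Ck_mul oU H H) Fv).
apply: (Ck_ext oU _ H) => x Ux /=.
rewrite (deriveV (f0 _ Ux) (fv _ Ux)) /GRing.scale /= expr2 invfM.
by rewrite /cst !mulN1r !mulNr.
Qed.

Lemma Ck_linear_comp V W Z k (U : set V) (L : {linear W -> Z}) (f : V -> W) :
  open U -> continuous L -> Ck k U f -> Ck k U (L \o f).
Proof.
move=> oU cL; elim: k f => [|k IH] f [cf df]; split => //;
  try by move=> x Ux; apply: continuous_comp; [exact: cf|exact: cL].
move=> v; have [fv Fv] := df v; split.
  by move=> x Ux; have [] := is_derive_linear cL (fv _ Ux).
apply: (Ck_ext oU _ (IH _ Fv)) => x Ux.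
by have [_ ->] := is_derive_linear cL (fv _ Ux).
Qed.

Lemma scalel_linear V (e : V) : linear ( *:%R ^~ e : R^o -> V).
Proof. by move=> a u v; rewrite scalerDl scalerA. Qed.

Lemma Ck_scalel V W k (U : set V) (f : V -> R^o) (e : W) :
  open U -> Ck k U f -> Ck k U (fun x => f x *: e).
Proof.
move=> oU Cf.
pose Lm := GRing.isLinear.Build _ _ _ _ _ (scalel_linear e).
pose L : {linear R^o -> W} := HB.pack ( *:%R ^~ e : R^o -> W) Lm.
apply: (@Ck_linear_comp _ _ _ _ _ L) => //; exact: scalel_continuous.
Qed.

Lemma Ck_coords V W {fd : fin_dim W} k (U : set V) (f : V -> W) : open U ->
  (forall i, Ck k U (fd_coord i \o f)) -> Ck k U f.
Proof.
move=> oU H.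
have := Ck_sum oU (fun i => Ck_scalel (fd_basis i) oU (H i)).
by apply: Ck_ext => // x _ /=; rewrite -fd_sum.
Qed.

End CkTheory.

(** * Mean value estimates *)

Section MeanValue.
Variables (R : realType) (V : normedModType R).
Implicit Types f : V -> R^o.

Lemma is_derive_line (W : normedModType R) (f : V -> W) p e (s : R) :
  derivable f (p + s *: e) e ->
  is_derive s 1 (fun t : R => f (p + t *: e)) ('D_e f (p + s *: e)).
Proof.
have E : (fun h : R => h^-1 *: (f (p + (h *: 1 + s) *: e) - f (p + s *: e))) =
    (fun h => h^-1 *: (f (h *: e + (p + s *: e)) - f (p + s *: e))).
  apply/funext => h; congr (_ *: (f _ - _)).
  by rewrite [h *: 1]mulr1 scalerDl addrCA.
by move=> df; apply: DeriveDef; rewrite /derivable /derive /= E.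
Qed.

Lemma derive_shiftE (W : normedModType R) (f : V -> W) w x e :
  ('D_e (fun y => f (y + w)) x = 'D_e f (x + w)) *
  (derivable (fun y => f (y + w)) x e = derivable f (x + w) e).
Proof.
have E : (fun h : R => h^-1 *: (f (h *: e + x + w) - f (x + w))) =
    (fun h => h^-1 *: (f (h *: e + (x + w)) - f (x + w))).
  by apply/funext => h; rewrite addrA.
by split; rewrite /derivable /derive /= E.
Qed.

(** Bounding the intermediate parameter by the absolute value of [t] treats both signs of [t] in one
    statement. *)
Lemma mean_value f p e (t : R) :
  (forall s : R, `|s| <= `|t| -> derivable f (p + s *: e) e) ->
  exists2 s : R, `|s| <= `|t| & f (p + t *: e) - f p = t * 'D_e f (p + s *: e).
Proof.
move=> df; pose g (s : R) := f (p + s *: e).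
have g0 : f p = g 0 by rewrite /g scale0r addr0.
have dg (s : R) : `|s| <= `|t| -> is_derive s 1 g ('D_e f (p + s *: e)).
  by move=> /df /is_derive_line.
have cg (s : R) : `|s| <= `|t| -> {for s, continuous g}.
  by move=> /dg [+ _] => /derivable1_diffP/differentiable_continuous.
have [t0|t0] := leP 0 t.
  have it (s : R) : s \in `[0, t] -> `|s| <= `|t|.
    by rewrite in_itv /= => /andP[s0 st]; rewrite !ger0_norm.
  have [|/= |c ci E] := @MVT_segment R g (fun s => 'D_e f (p + s *: e)) 0 t t0.
  - by move=> s si; apply: dg; apply: it; exact: subset_itv_oo_cc si.
  - apply: continuous_in_subspaceT => s; rewrite inE => /it; exact: cg.
  exists c; first exact: it.
  by rewrite g0 E subr0 mulrC.
have it (s : R) : s \in `[t, 0] -> `|s| <= `|t|.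
  by rewrite in_itv /= => /andP[s0 st]; rewrite !ler0_norm // ?lerN2 // ltW.
have [|/= |c ci E] := @MVT_segment R g (fun s => 'D_e f (p + s *: e)) t 0 (ltW t0).
- by move=> s si; apply: dg; apply: it; exact: subset_itv_oo_cc si.
- apply: continuous_in_subspaceT => s; rewrite inE => /it; exact: cg.
exists c; first exact: it.
by rewrite g0 -opprB E sub0r mulrN opprK mulrC.
Qed.

(** The second difference of [f] along [t u] and [t v] is symmetric in [u] and [v]. Computed in
    either order it is [t^2] times one of the mixed derivatives at a point near [x]; continuity at
    [x] then makes the two mixed derivatives at [x] differ by at most any [e]. *)
Lemma Ck2_derive_sym (U : set V) f x u v : open U -> Ck 2 U f -> U x ->
  'D_u ('D_v f) x = 'D_v ('D_u f) x.
Proof.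
move=> oU Cf Ux; have [cf df] := Cf.
have [du [_ /(_ v)[dvu [cvu _]]]] := df u.
have [dv [_ /(_ u)[duv [cuv _]]]] := df v.
apply/eqP; rewrite -subr_eq0 -normr_le0; apply/ler_addgt0Pr => e e0; rewrite add0r.
have e2 : 0 < e / 2 by rewrite divr_gt0.
have near2 (g1 g2 : V -> R^o) : {for x, continuous g1} -> {for x, continuous g2} ->
    exists2 r : R, 0 < r & forall y, ball x r y ->
    [/\ U y, `|g1 x - g1 y| <= e / 2 & `|g2 x - g2 y| <= e / 2].
  move=> /cvgrPdist_le/(_ _ e2) n1 /cvgrPdist_le/(_ _ e2) n2.
  have nU := open_nbhs_nbhs (conj oU Ux).
  have : \forall y \near x, [/\ U y, `|g1 x - g1 y| <= e / 2 & `|g2 x - g2 y| <= e / 2].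
    by apply: filterS3 nU n1 n2 => y Uy h1 h2.
  by move=> /nbhs_ballP[r r0 Hr]; exists r.
have [A AE] : exists A : V -> R^o, forall y, 'D_v ('D_u f) y = A y.
  by exists (fun y => 'D_v ('D_u f) y).
have [B BE] : exists B : V -> R^o, forall y, 'D_u ('D_v f) y = B y.
  by exists (fun y => 'D_u ('D_v f) y).
have cA : {for x, continuous A}.
  by have /funext <- := AE; exact: cvu.
have cB : {for x, continuous B}.
  by have /funext <- := BE; exact: cuv.
rewrite AE BE; have [r r0 Hr] := near2 _ _ cA cB.
(* The summand 1 keeps [M] positive; with [t = r / (2 M)] every [x + a u + b v] with |a| and |b| at
   most [t] stays in the ball of radius [r]. *)
pose M := `|u| + `|v| + 1.
have M0 : 0 < M by rewrite ltr_wpDl // addr_ge0.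
pose t := r / (2 * M).
have t0 : 0 < t by rewrite divr_gt0 // mulr_gt0.
have inb (a b : R) : `|a| <= `|t| -> `|b| <= `|t| ->
    ball x r (x + a *: u + b *: v).
  move=> at_ bt; rewrite -ball_normE /= opprD addrA opprD addrA subrr sub0r.
  rewrite -opprD normrN; apply: le_lt_trans (ler_normD _ _) _; rewrite !normrZ.
  apply: (@le_lt_trans _ _ (t * M)).
    rewrite (ger0_norm (ltW t0)) in at_ bt.
    rewrite /M !mulrDr mulr1; apply: ler_wpDr; first exact: ltW.
    by apply: lerD; apply: ler_wpM2r.
  rewrite /t invfM mulrA -mulrA mulVf ?gt_eqF // mulr1.
  by rewrite ltr_pdivrMr // ltr_pMr // ltr1n.
(* The mean value theorem is applied along [a] to the difference [F], then along [b] to ['D_a f]. *)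
have key (a b : V) (C : V -> R^o) (CE : forall y, 'D_b ('D_a f) y = C y) :
    (forall s s' : R, `|s| <= `|t| -> `|s'| <= `|t| ->
    U (x + s *: a + s' *: b)) ->
    (forall y, U y -> derivable f y a) -> (forall y, U y -> derivable ('D_a f) y b) ->
    exists s s' : R, [/\ `|s| <= `|t|, `|s'| <= `|t| &
    f (x + t *: a + t *: b) - f (x + t *: a) - (f (x + t *: b) - f x) =
      t * (t * C (x + s *: a + s' *: b))].
  move=> Uab da dba; pose F := fun y => f (y + t *: b) - f y.
  have U0 (s : R) : `|s| <= `|t| -> U (x + s *: a).
    by move=> st; have := Uab s 0 st; rewrite scale0r addr0 normr0; apply.
  have dsh (s : R) : `|s| <= `|t| -> derivable (fun y => f (y + t *: b)) (x + s *: a) a.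
    by move=> st; rewrite derive_shiftE; apply: da; exact: Uab.
  have dF (s : R) : `|s| <= `|t| -> derivable F (x + s *: a) a.
    by move=> st; apply: derivableB; [exact: dsh|apply: da; exact: U0].
  have [s st E] := mean_value dF.
  have [|s' st' E'] := @mean_value ('D_a f) (x + s *: a) b t.
    by move=> s' st'; apply: dba; exact: Uab.
  exists s, s'; split => //; rewrite -CE -E' -/(F _) -/(F _) E; congr (_ * _).
  by have -> := deriveB (dsh _ st) (da _ (U0 _ st)); rewrite derive_shiftE.
have Uuv (s s' : R) : `|s| <= `|t| -> `|s'| <= `|t| -> U (x + s *: u + s' *: v).
  by move=> st st'; have [] := Hr _ (inb _ _ st st').
have Uvu (s s' : R) : `|s| <= `|t| -> `|s'| <= `|t| -> U (x + s *: v + s' *: u).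
  by move=> st st'; rewrite addrAC; exact: Uuv.
have [s [s' [st st' E]]] := key u v A AE Uuv du dvu.
have [r1 [r1' [rt rt' E']]] := key v u B BE Uvu dv duv.
have EE : A (x + s *: u + s' *: v) = B (x + r1' *: u + r1 *: v).
  have tn : t != 0 by rewrite gt_eqF.
  apply: (mulfI tn); apply: (mulfI tn).
  rewrite -E [x + r1' *: u + _]addrAC -E' (addrAC x).
  rewrite -!addrA; congr (_ + _); rewrite !opprB addrCA [RHS]addrCA.
  by congr (_ + _); exact: addrC.
have [_ H1 _] := Hr _ (inb _ _ st st').
have [_ _ H2] := Hr _ (inb _ _ rt' rt).
rewrite (splitr e) -(subrKA (A (x + s *: u + s' *: v))) addrC.
apply: le_trans (ler_normD _ _) _; apply: lerD; first by rewrite distrC.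
by rewrite EE.
Qed.

(** The increment from [x] to [h + x] is split along the coordinate axes. On each leg the mean value
    theorem gives a partial derivative at a point near [x], which continuity compares with the one
    at [x]. *)
Lemma C1_differentiable {fd : fin_dim V} (U : set V) f x : open U ->
  Ck 1 U f -> U x -> differentiable f x.
Proof.
move=> oU [cf df] Ux.
pose N := @fd_dim _ _ fd.
pose a (i : 'I_N) := 'D_(fd_basis i) f x.
pose L0 (h : V) : R^o := \sum_i fd_coord i h * a i.
have L0lin : linear L0.
  move=> k u v; rewrite /L0 scaler_sumr -big_split; apply: eq_bigr => i _.
  by rewrite linearP mulrDl [in RHS]/GRing.scale /= mulrA.
have [k kP] : exists k : 'I_N -> R,
    forall i, 0 < k i /\ forall h, `|fd_coord i h| <= k i * `|h|.
  have H i : exists k : R, 0 < k /\ forall h, `|fd_coord i h| <= k * `|h|.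
    by have [k k0 Hk] := linear_lipschitz (@fd_coord_continuous _ _ fd i); exists k.
  by exists (fun i => projT1 (cid (H i))) => i; exact: projT2 (cid (H i)).
pose Lm := GRing.isLinear.Build _ _ _ _ _ L0lin.
pose L : {linear V -> R^o} := HB.pack L0 Lm.
have cL : continuous L.
  move=> h; rewrite /continuous_at /= /L0.
  apply: cvg_big => [|i _]; first exact: add_continuous.
  by apply: cvgMl; exact: fd_coord_continuous.
have E : f \o shift x = cst (f x) + L +o_ (0 : V) id.
  apply/eqaddoP => e e0.
  (* [K] bounds the sum of the coordinates of [h], and [M] the length of the path along the axes,
     both relative to the norm of [h]; below, 1 is added to each to avoid dividing by zero. *)
  pose K := \sum_i k i; pose M := \sum_i k i * `|@fd_basis _ _ fd i|.
  have K0 : 0 <= K by apply: sumr_ge0 => i _; exact: ltW (kP i).1.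
  have M0 : 0 <= M by apply: sumr_ge0 => i _; apply: mulr_ge0 => //; exact: ltW (kP i).1.
  pose eta := e / (K + 1).
  have eta0 : 0 < eta by rewrite divr_gt0 // ltr_wpDl.
  have : \forall y \near x, U y /\
      forall i, `|a i - 'D_(fd_basis i) f y| <= eta.
    apply: filterI; first exact: open_nbhs_nbhs.
    apply: filter_forall => i; have [_ [/(_ _ Ux) + _]] := df (fd_basis i).
    by move=> /cvgrPdist_le/(_ _ eta0).
  move=> /nbhs_ballP[r /= r0 Hr].
  have : \forall h \near (0 : V), `|h| < r / (M + 1).
    have : 0 < r / (M + 1) by rewrite divr_gt0 // ltr_wpDl.
    move=> q0; have := nbhsx_ballx (0 : V) _ q0; apply: filterS => h.
    by rewrite -ball_normE /= sub0r normrN.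
  apply: filterS => h hr /=.
  (* The vertices of the path: in [p j] the first [j] coordinates of [h] have been added. *)
  pose p j := x + \sum_(i < N | (i < j)%N) fd_coord i h *: fd_basis i.
  have pS (j : 'I_N) : p j.+1 = p j + fd_coord j h *: fd_basis j.
    rewrite /p -addrA; congr (_ + _); rewrite (bigD1 j) //= addrC; congr (_ + _).
    by apply: eq_bigl => i; rewrite ltnS ltn_neqAle andbC.
  have pb (j : 'I_N) (s : R) : `|s| <= `|fd_coord j h| -> ball x r (p j + s *: fd_basis j).
    move=> sj; rewrite -ball_normE /= /p -addrA opprD addrA subrr sub0r normrN.
    apply: (@le_lt_trans _ _ (M * `|h|)); last first.
      apply: (@le_lt_trans _ _ ((M + 1) * `|h|)).
        by rewrite ler_wpM2r // lerDl.
      by rewrite mulrC -ltr_pdivlMr // ltr_wpDl.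
    apply: le_trans (ler_normD _ _) _.
    rewrite /M mulr_suml [leRHS](bigID (fun i : 'I_N => (i < j)%N)) /=; apply: lerD.
      apply: le_trans (ler_norm_sum _ _ _) _; apply: ler_sum => i _.
      by rewrite normrZ mulrAC ler_wpM2r // (kP i).2.
    rewrite (bigD1 j) ?ltnn //= -[leLHS]addr0; apply: lerD; last first.
      by apply: sumr_ge0 => i _; rewrite !mulr_ge0 // ltW // (kP i).1.
    rewrite normrZ mulrAC ler_wpM2r //; apply: le_trans sj _; exact: (kP j).2.
  have pN : p N = h + x.
    rewrite addrC /p [in RHS](fd_sum h); congr (_ + _).
    by apply: eq_bigl => i; rewrite ltn_ord.
  have p0 : p 0 = x by rewrite /p big_pred0 ?addr0.
  have mv (j : 'I_N) : exists2 y, ball x r y &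
      f (p j.+1) - f (p j) = fd_coord j h * 'D_(fd_basis j) f y.
    have [|s sj Es] := @mean_value f (p j) (fd_basis j) (fd_coord j h).
      by move=> s sj; apply: (df _).1; exact: (Hr _ (pb _ _ sj)).1.
    by exists (p j + s *: fd_basis j); [exact: pb|rewrite pS Es].
  have -> : (f \o shift x - (cst (f x) + L)) h =
      \sum_(j < N) (f (p j.+1) - f (p j) - fd_coord j h * a j).
    rewrite sumrB -(big_mkord xpredT (fun j => f (p j.+1) - f (p j))).
    rewrite telescope_sumr // pN p0 -[LHS]/(f (h + x) - (f x + L0 h)).
    by rewrite opprD addrA.
  apply: le_trans (ler_norm_sum _ _ _) _.
  apply: (@le_trans _ _ (\sum_(j < N) k j * `|h| * eta)).
    apply: ler_sum => j _; have [y yb ->] := mv j.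
    rewrite -mulrBr normrM; apply: ler_pM => //; first exact: (kP j).2.
    by rewrite distrC; exact: (Hr _ yb).2.
  rewrite -mulr_suml -mulr_suml -/K /eta mulrC mulrA ler_wpM2r //.
  rewrite -mulrA; apply: ler_piMr; first exact: ltW.
  by rewrite mulrC ler_pdivrMr ?mul1r ?lerDl // ltr_wpDl.
have DL : 'd f x = L :> (V -> R^o) by exact: diff_unique.
by apply/diff_locallyP; rewrite DL; split.
Qed.

End MeanValue.

(** * Smooth germs *)

Section FinDimInstances.
Variable R : realType.

Definition rV_coord m (i : 'I_m) (v : 'rV[R]_m) : R^o := v 0 i.

Lemma rV_coord_linear m (i : 'I_m) : linear (rV_coord i).
Proof. by move=> a u v; rewrite /rV_coord !mxE. Qed.

HB.instance Definition _ m (i : 'I_m) :=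
  GRing.isLinear.Build _ _ _ _ (rV_coord i) (rV_coord_linear i).

Lemma rV_coord_sum m (v : 'rV[R]_m) : v = \sum_i rV_coord i v *: delta_mx 0 i.
Proof. exact: row_sum_delta. Qed.

#[export] Instance rV_fin_dim m : fin_dim 'rV[R]_m :=
  @FinDim R 'rV[R]_m m (fun i => delta_mx 0 i) (fun i => rV_coord i)
    (fun i => @coord_continuous R 1 m 0 i) (@rV_coord_sum m).

#[export] Instance R_fin_dim : fin_dim R^o.
Proof.
refine (@FinDim R R^o 1 (fun=> 1) (fun=> idfun) _ _).
- by move=> i x; exact: cvg_id.
- by move=> v; rewrite big_ord1 /= /GRing.scale /= mulr1.
Defined.

End FinDimInstances.

Section ProdFinDim.
Variables (R : realType) (V W : normedModType R).
Context {fV : fin_dim V} {fW : fin_dim W}.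

Definition prod_coord (i : 'I_(@fd_dim _ _ fV + @fd_dim _ _ fW)) (z : V * W) : R^o :=
  match fintype.split i with inl j => fd_coord j z.1 | inr j => fd_coord j z.2 end.

Lemma prod_coord_linear i : linear (prod_coord i).
Proof. by move=> a u v; rewrite /prod_coord; case: fintype.split => j; rewrite linearP. Qed.

HB.instance Definition _ i :=
  GRing.isLinear.Build _ _ _ _ (prod_coord i) (prod_coord_linear i).

Lemma prod_coord_continuous i : continuous (prod_coord i).
Proof.
rewrite /prod_coord; case: fintype.split => j z.
  by apply: (@continuous_comp _ _ _ fst (fd_coord j)); [exact: cvg_fst|exact: fd_coord_continuous].
by apply: (@continuous_comp _ _ _ snd (fd_coord j)); [exact: cvg_snd|exact: fd_coord_continuous].
Qed.

#[export] Instance prod_fin_dim : fin_dim (V * W)%type.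
Proof.
refine (@FinDim R (V * W)%type (@fd_dim _ _ fV + @fd_dim _ _ fW)
  (fun i => match fintype.split i with inl j => (fd_basis j, 0) | inr j => (0, fd_basis j) end)
  (fun i => prod_coord i) prod_coord_continuous _).
move=> [v w]; rewrite big_split_ord /=.
under eq_bigr do rewrite /prod_coord; under [X in _ = _ + X]eq_bigr do rewrite /prod_coord.
rewrite [X in X + _](_ : _ = (v, 0)); last first.
  under eq_bigr do rewrite (unsplitK (inl _)) /=.
  rewrite [in RHS](fd_sum v).
  by elim/big_rec2 : _ => //= i y1 y2 _ ->; congr pair; rewrite /= scaler0 add0r.
rewrite [X in _ + X](_ : _ = (0, w)); last first.
  under eq_bigr do rewrite (unsplitK (inr _)) /=.
  rewrite [in RHS](fd_sum w).
  by elim/big_rec2 : _ => //= i y1 y2 _ ->; congr pair; rewrite /= scaler0 add0r.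
by congr pair; rewrite /= ?addr0 ?add0r.
Defined.

End ProdFinDim.

Section CkComp.
Variable R : realType.
Implicit Types V W Z : normedModType R.

Lemma C1_differentiable_vect V W {fV : fin_dim V} {fW : fin_dim W} (U : set V)
    (f : V -> W) x : open U -> Ck 1 U f -> U x -> differentiable f x.
Proof.
move=> oU Cf Ux.
have -> : f = \sum_i (fun y => fd_coord i (f y) *: fd_basis i).
  by apply/funext => y; rewrite fct_sumE [LHS]fd_sum.
apply: differentiable_sum => i; apply: differentiableZl.
apply: (C1_differentiable (f := fd_coord i \o f) oU) => //.
by apply: Ck_linear_comp => //; exact: fd_coord_continuous.
Qed.

(** Induction on [k]: the derivative of the composite is the sum of the coordinates of ['D_v g]
    times the partial derivatives of [f] composed with [g], and all these factors are of class C^k.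
    Scalar values of [f] let products of functions suffice. *)
Lemma Ck_comp_scalar V W {fW : fin_dim W} k (U : set V) (U' : set W)
    (g : V -> W) (f : W -> R^o) : open U -> open U' ->
  (forall x, U x -> U' (g x)) -> Ck k U g -> Ck k U' f -> Ck k U (f \o g).
Proof.
move=> oU oU' UU'; elim: k g f UU' => [|k IH] g f UU' Cg Cf.
  by split => // x Ux; apply: continuous_comp; [exact: Cg.1|exact: Cf.1 (UU' _ Ux)].
have C1f : Ck 1 U' f.
  case: (Cf) => cf df; split => // v; have [dv Cv] := df v.
  by split => //; split => //; exact: Ck_continuous Cv.
have dif y : U' y -> differentiable f y by exact: C1_differentiable.
have [cg dg] := Cg; have [cf df] := Cf.
split; first by move=> x Ux; apply: continuous_comp; [exact: cg|exact: cf (UU' _ Ux)].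
move=> v; have [gv Gv] := dg v; split.
  by move=> x Ux; have [] := is_derive_comp (gv _ Ux) (dif _ (UU' _ Ux)).
have H i : Ck k U (fun x => fd_coord i ('D_v g x) * 'D_(fd_basis i) f (g x)).
  apply: Ck_mul => //.
    by apply: (@Ck_linear_comp _ _ _ _ _ _ (fd_coord i) ('D_v g)) => //; exact: fd_coord_continuous.
  by apply: (IH g ('D_(fd_basis i) f) UU' (CkS Cg)); have [] := df (fd_basis i).
apply: (Ck_ext oU _ (Ck_sum oU H)) => x Ux.
by rewrite (derive_comp (gv _ Ux) (dif _ (UU' _ Ux))) derive_basis //; exact: dif (UU' _ Ux).
Qed.

Lemma Ck_comp V W Z {fW : fin_dim W} {fZ : fin_dim Z} k (U : set V) (U' : set W)
    (g : V -> W) (f : W -> Z) : open U -> open U' ->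
  (forall x, U x -> U' (g x)) -> Ck k U g -> Ck k U' f -> Ck k U (f \o g).
Proof.
move=> oU oU' UU' Cg Cf; apply: Ck_coords => // i.
apply: (@Ck_comp_scalar _ _ _ _ _ U' g (fd_coord i \o f)) => //.
by apply: Ck_linear_comp => //; exact: fd_coord_continuous.
Qed.

End CkComp.

(** One neighbourhood serves all orders of differentiation, so smoothness at [x] passes to nearby
    points and to derivatives. *)
Definition smooth_at (R : realType) (V W : normedModType R) (f : V -> W) (x : V) : Prop :=
  exists2 U : set V, open U /\ U x & smooth_on U f.

Lemma near_open (T : topologicalType) (P : T -> Prop) (x : T) :
  (\forall y \near x, P y) -> exists2 A : set T, open A /\ A x & forall y, A y -> P y.
Proof. by rewrite /prop_near1 nbhsE => -[A [oA Ax] AP]; exists A. Qed.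

Section SmoothAt.
Variable R : realType.
Implicit Types V W Z : normedModType R.

Lemma smooth_at_on V W (U : set V) (f : V -> W) :
  (forall x, U x -> smooth_at f x) -> smooth_on U f.
Proof.
move=> H k; apply: Ck_pointwise => x /H [U' [oU' U'x] sf].
by apply: Ck_subset (sf k) => y ->.
Qed.

Lemma smooth_at_near V W (f : V -> W) x :
  smooth_at f x -> \forall y \near x, smooth_at f y.
Proof.
move=> [U [oU Ux] sf]; move: (open_nbhs_nbhs (conj oU Ux)).
by apply: filterS => y Uy; exists U.
Qed.

Lemma smooth_at_ext V W (f g : V -> W) x :
  {near x, f =1 g} -> smooth_at f x -> smooth_at g x.
Proof.
move=> /near_open[A [oA Ax] Afg] [U [oU Ux] sf].
exists (A `&` U); first by split => //; exact: openI.
move=> k; apply: (@Ck_ext _ _ _ _ _ f); first exact: openI.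
  by move=> y [/Afg].
by apply: Ck_subset (sf k) => y [].
Qed.

Lemma smooth_at_continuous V W (f : V -> W) x :
  smooth_at f x -> {for x, continuous f}.
Proof. by move=> [U [oU Ux] /(_ 0)[H _]]; exact: H. Qed.

Lemma smooth_at_derivable V W (f : V -> W) x v :
  smooth_at f x -> derivable f x v.
Proof. by move=> [U [oU Ux] /(_ 1)[_ /(_ v)[H _]]]; exact: H. Qed.

Lemma smooth_at_differentiable V W {fV : fin_dim V} {fW : fin_dim W}
    (f : V -> W) x : smooth_at f x -> differentiable f x.
Proof. by move=> [U [oU Ux] /(_ 1) sf]; exact: C1_differentiable_vect Ux. Qed.

Lemma smooth_at_derive V W (f : V -> W) x v :
  smooth_at f x -> smooth_at ('D_v f) x.
Proof.
move=> [U [oU Ux] sf]; exists U => // k.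
by have [_ /(_ v)[]] := sf k.+1.
Qed.

Lemma smooth_at_cst V W (a : W) (x : V) : smooth_at (fun=> a) x.
Proof.
exists setT; first by split => //; exact: openT.
by move=> k; exact: Ck_cst.
Qed.

Lemma smooth_at_linear V W (L : {linear V -> W}) x : continuous L -> smooth_at L x.
Proof.
move=> cL; exists setT; first by split => //; exact: openT.
by move=> k; exact: Ck_linear.
Qed.

Lemma smooth_at_linear_comp V W Z (L : {linear W -> Z}) (f : V -> W) x :
  continuous L -> smooth_at f x -> smooth_at (fun y => L (f y)) x.
Proof. by move=> cL [U [oU Ux] sf]; exists U => // k; exact: Ck_linear_comp. Qed.

Lemma smooth_at_id V (x : V) : smooth_at (fun y => y) x.
Proof. by apply: (@smooth_at_linear V V idfun) => y; exact: cvg_id. Qed.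

Lemma smooth_at_scalar2 V (op : (V -> R^o) -> (V -> R^o) -> V -> R^o) :
  (forall k (U : set V) f g, open U -> Ck k U f -> Ck k U g -> Ck k U (op f g)) ->
  forall f g x, smooth_at f x -> smooth_at g x -> smooth_at (op f g) x.
Proof.
move=> H f g x [U [oU Ux] sf] [U' [oU' U'x] sg]; exists (U `&` U').
  by split => //; exact: openI.
move=> k; apply: H; first exact: openI.
  by apply: Ck_subset (sf k) => y [].
by apply: Ck_subset (sg k) => y [].
Qed.

Lemma smooth_at_add V (f g : V -> R^o) x :
  smooth_at f x -> smooth_at g x -> smooth_at (fun y => f y + g y) x.
Proof. by apply: (@smooth_at_scalar2 _ (fun f g y => f y + g y)) => k U f' g'; exact: Ck_add. Qed.

Lemma smooth_at_mul V (f g : V -> R^o) x :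
  smooth_at f x -> smooth_at g x -> smooth_at (fun y => f y * g y) x.
Proof. by apply: (@smooth_at_scalar2 _ (fun f g y => f y * g y)) => k U f' g'; exact: Ck_mul. Qed.

Lemma smooth_at_opp V (f : V -> R^o) x :
  smooth_at f x -> smooth_at (fun y => - f y) x.
Proof.
move=> sf; have := smooth_at_mul (smooth_at_cst (-1 : R^o) x) sf.
by congr smooth_at; apply/funext => y; rewrite mulN1r.
Qed.

Lemma smooth_at_inv V (f : V -> R^o) x : f x != 0 ->
  smooth_at f x -> smooth_at (fun y => (f y)^-1) x.
Proof.
move=> fx0 sf.
have nf : \forall y \near x, f y != 0.
  have /(_ _ (open_nbhs_nbhs (conj (@open_neq R 0) fx0))) := smooth_at_continuous sf.
  exact.
case: sf => U [oU Ux] sf.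
move: nf => /near_open[A [oA Ax] Af]; exists (A `&` U).
  by split => //; exact: openI.
move=> k; apply: Ck_inv; first exact: openI.
  by move=> y [/Af].
by apply: Ck_subset (sf k) => y [].
Qed.

Lemma smooth_at_coords V W {fW : fin_dim W} (f : V -> W) x :
  (forall i, smooth_at (fun y => fd_coord i (f y)) x) -> smooth_at f x.
Proof.
move=> H; have : \forall y \near x, forall i, smooth_at (fun z => fd_coord i (f z)) y.
  by apply: filter_forall => i; exact: smooth_at_near.
move=> /near_open[A [oA Ax] Af]; exists A => // k.
apply: Ck_coords => // i; apply: smooth_at_on => y Ay; exact: Af.
Qed.

Lemma smooth_at_comp V W Z {fW : fin_dim W} {fZ : fin_dim Z}
    (g : V -> W) (f : W -> Z) x :
  smooth_at g x -> smooth_at f (g x) -> smooth_at (fun y => f (g y)) x.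
Proof.
move=> sg [U' [oU' U'x] sf].
have nU : \forall y \near x, smooth_at g y /\ U' (g y).
  apply: filterI; first exact: smooth_at_near.
  exact: (smooth_at_continuous sg (open_nbhs_nbhs (conj oU' U'x))).
move: nU => /near_open[A [oA Ax] Af]; exists A => // k.
apply: (@Ck_comp _ _ _ _ _ _ k A U' g f) => //; first by move=> y /Af [].
by apply: smooth_at_on => y /Af [].
Qed.

Lemma smooth_at_pair V W Z {fW : fin_dim W} {fZ : fin_dim Z}
    (f : V -> W) (g : V -> Z) x :
  smooth_at f x -> smooth_at g x -> smooth_at (fun y => (f y, g y)) x.
Proof.
move=> sf sg; apply: smooth_at_coords => i /=.
rewrite /prod_coord; case: fintype.split => j /=;
  by apply: smooth_at_linear_comp => //; exact: fd_coord_continuous.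
Qed.

Lemma smooth_at_fst V W (z : V * W) : smooth_at fst z.
Proof. by apply: (smooth_at_linear (L := fst)) => y; exact: cvg_fst. Qed.

Lemma smooth_at_snd V W (z : V * W) : smooth_at snd z.
Proof. by apply: (smooth_at_linear (L := snd)) => y; exact: cvg_snd. Qed.

Lemma smooth_at_rV V m (f : V -> 'rV[R]_m) x :
  (forall i, smooth_at (fun y => f y 0 i : R^o) x) -> smooth_at f x.
Proof. by move=> H; exact: smooth_at_coords. Qed.

Lemma smooth_at_coord V m (f : V -> 'rV[R]_m) x i :
  smooth_at f x -> smooth_at (fun y => f y 0 i : R^o) x.
Proof.
by move=> sf; apply: (smooth_at_linear_comp (L := rV_coord i)) => //; exact: coord_continuous.
Qed.

Lemma derive_coord V m (f : V -> 'rV[R]_m) x v i :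
  derivable f x v -> 'D_v (fun y => f y 0 i : R^o) x = 'D_v f x 0 i.
Proof.
by move=> df; have [_ ->] := is_derive_linear (L := rV_coord i) (@coord_continuous R 1 m 0 i) df.
Qed.

Lemma derive_sym V (f : V -> R^o) x u v :
  smooth_at f x -> 'D_u ('D_v f) x = 'D_v ('D_u f) x.
Proof. by move=> [U [oU Ux] sf]; exact: Ck2_derive_sym (sf 2) Ux. Qed.

Lemma derive_sym_rV V m (f : V -> 'rV[R]_m) x u v :
  smooth_at f x -> 'D_u ('D_v f) x = 'D_v ('D_u f) x.
Proof.
move=> sf; apply/rowP => i.
have E a b : 'D_a ('D_b f) x 0 i = 'D_a ('D_b (fun y => f y 0 i : R^o)) x.
  rewrite -derive_coord; last exact/smooth_at_derivable/smooth_at_derive.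
  apply: near_eq_derive; apply: filterS (smooth_at_near sf) => y sy.
  by rewrite derive_coord //; exact: smooth_at_derivable.
have S := derive_sym u v (smooth_at_coord i sf).
exact: etrans (E u v) (etrans S (esym (E v u))).
Qed.

End SmoothAt.

(** * The Lie-Kolchin theorem *)

Section Subgroups.
Variable G : groupType.
Implicit Types (K : set G) (x y : G).

Lemma subgroupV K x : subgroup K -> K x -> K x^-1%g.
Proof. by move=> [K1 KB] Kx; rewrite -[x^-1%g]mul1g; exact: KB. Qed.

Lemma subgroupM K x y : subgroup K -> K x -> K y -> K (x * y)%g.
Proof. by move=> sK Kx Ky; rewrite -[y]invgK; apply: sK.2 => //; exact: subgroupV. Qed.

Lemma subgroup_commg K x y : subgroup K -> K x -> K y -> K [~ x, y]%g.
Proof.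
move=> sK Kx Ky; rewrite commgEl conjgE.
by do ?[apply: subgroupM => //]; exact: subgroupV.
Qed.

Lemma subgroup_generated (S : set G) : subgroup (generated S).
Proof.
split=> [K [K1 _] _ //|x y Hx Hy K sK SK].
by apply: sK.2; [exact: Hx|exact: Hy].
Qed.

Lemma subgroup_derived K : subgroup (derived_subgroup K).
Proof. exact: subgroup_generated. Qed.

Lemma derived_sub K : subgroup K -> derived_subgroup K `<=` K.
Proof.
by move=> sK x; apply => // z [a [b [Ka Kb ->]]]; exact: subgroup_commg.
Qed.

Lemma derived_commg K x y : K x -> K y -> derived_subgroup K [~ x, y]%g.
Proof. by move=> Kx Ky L sL; apply; exists x, y. Qed.

Lemma derived_conj K x y : subgroup K -> K x -> derived_subgroup K y ->
  derived_subgroup K (x * y * x^-1)%g.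
Proof.
move=> sK Kx dy.
have -> : (x * y * x^-1 = y * [~ y, x^-1])%g.
  by rewrite commgEl conjgE invgK mulgA mulgV mul1g mulgA.
apply: (subgroupM (subgroup_derived K)) => //.
by apply: derived_commg; [exact: derived_sub|exact: subgroupV].
Qed.

End Subgroups.

(** * Connectedness through functions with finitely many values *)

Section Rigid.
Variables (R : realType) (G : topologicalGroupType).
Implicit Types (K : set G).

(** The function is continuous on all of [G]; only its values on [K] are finite in number. *)
Definition rigid K : Prop := forall f : G -> R, continuous f ->
  (exists s : seq R, forall x, K x -> f x \in s) -> forall x, K x -> f x = f 1%g.

Lemma mulg_continuous2 (T : topologicalType) (f g : T -> G) :
  continuous f -> continuous g -> continuous (fun x => (f x * g x)%g).
Proof.
move=> cf cg x.
apply: (@continuous_comp _ _ _ (fun x => (f x, g x)) (fun z => (z.1 * z.2)%g)).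
  by apply: cvg_pair; [exact: cf|exact: cg].
exact: mulg_continuous.
Qed.

Lemma invg_continuous_comp (T : topologicalType) (f : T -> G) :
  continuous f -> continuous (fun x => (f x)^-1%g).
Proof.
move=> cf x; apply: (@continuous_comp _ _ _ f (fun z => z^-1%g)); first exact: cf.
exact: invg_continuous.
Qed.

(** The elements of the derived subgroup whose right translation does not change [f] there form a
    subgroup [L]. It contains every commutator [[~ a, b]]: as [a] runs through [K], [f (z *
    [~ a, b])] takes finitely many values, hence equals its value [f z] at [a = 1]. *)
Lemma rigid_derived K : subgroup K -> rigid K -> rigid (derived_subgroup K).
Proof.
move=> sK rK f cf [s fs].
pose stab : set G := [set c | forall z, derived_subgroup K z -> f (z * c)%g = f z].
pose L := derived_subgroup K `&` stab.
have sL : subgroup L.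
  split; first by split=> [|z _]; [exact: (subgroup_derived K).1|rewrite mulg1].
  move=> x y [dx sx] [dy sy]; split; first exact: (subgroup_derived K).2.
  move=> z dz; rewrite -(sy (z * (x * y^-1))%g); last first.
    by apply: (subgroupM (subgroup_derived K)) => //; exact: (subgroup_derived K).2.
  by rewrite -!mulgA mulVg mulg1; exact: sx.
have dL : derived_subgroup K `<=` L.
  move=> x; apply => // _ [a [b [Ka Kb ->]]]; split; first exact: derived_commg.
  move=> z dz.
  have := rK (fun a => f (z * [~ a, b])%g) _ _ a Ka.
  rewrite comm1g mulg1; apply.
    move=> x0; apply: (@continuous_comp _ _ _ (fun a => (z * [~ a, b])%g) f); last exact: cf.
    apply: mulg_continuous2; first exact: cst_continuous.
    rewrite /commg /conjg; apply: mulg_continuous2; first by move=> ?; exact: invg_continuous.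
    apply: mulg_continuous2; first exact: cst_continuous.
    by apply: mulg_continuous2; [move=> ?; exact: cvg_id|exact: cst_continuous].
  exists s => a' Ka'; apply: fs; apply: (subgroupM (subgroup_derived K)) => //.
  exact: derived_commg.
move=> x dx; have [_ /(_ 1%g)] := dL _ dx.
by rewrite mul1g; apply; exact: (subgroup_derived K).1.
Qed.

Lemma notin_between (s : seq R) (a b : R) : a < b -> exists2 c, a < c < b & c \notin s.
Proof.
(* Starting the denominators at 2 keeps the points strictly below [b]; there is one more of them
   than entries in [s]. *)
move=> ab; pose F (k : 'I_(size s).+1) : R := a + (b - a) / (k.+2%:R).
have Fb k : a < F k < b.
  rewrite /F ltrDl divr_gt0 ?subr_gt0 //= -ltrBrDl ltr_pdivrMr //.
  by rewrite ltr_pMr ?subr_gt0 // ltr1n.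
have Finj : injective F.
  move=> i j /addrI /mulfI H; apply/val_inj.
  have := H (lt0r_neq0 _); rewrite subr_gt0 => /(_ ab) /invr_inj /eqP.
  by rewrite eqr_nat => /eqP [].
have [k kn] : exists k, F k \notin s.
  apply/existsP; rewrite -[X in is_true X]negbK; apply/negP.
  rewrite negb_exists => /forallP H.
  have us : uniq (codom F) by rewrite map_inj_uniq ?enum_uniq.
  have ss : {subset codom F <= s} by move=> _ /codomP[k ->]; have := H k; rewrite negbK.
  by have := uniq_leq_size us ss; rewrite size_codom card_ord ltnn.
by exists (F k).
Qed.

(** By the intermediate value theorem along a path, two distinct values would force a value outside
    the finite list. *)
Lemma path_connected_rigid : path_connected R G -> rigid [set: G].
Proof.
move=> pc f cf [s fs] x _; have [c [cc c0 c1]] := pc 1%g x.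
pose g t := f (c t).
have cg : {within `[0, 1], continuous g}.
  move=> t; apply: (@continuous_comp _ _ _ (c : subspace `[0, 1] -> G) f); first exact: cc.
  exact: cf.
rewrite -c1 -c0 -/(g 0) -/(g 1).
apply/eqP; case: (ltgtP (g 0) (g 1)) => // [lt|lt]; exfalso.
- have [v /andP[v0 v1] vs] := notin_between s lt.
  have [|t _ gt] := @IVT R g 0 1 v ler01 cg.
    by rewrite ge_min le_max (ltW v0) (ltW v1) orbT.
  by move: vs; rewrite -gt fs.
- have [v /andP[v0 v1] vs] := notin_between s lt.
  have [|t _ gt] := @IVT R g 0 1 v ler01 cg.
    by rewrite ge_min le_max (ltW v0) (ltW v1) orbT.
  by move: vs; rewrite -gt fs.
Qed.

Definition ccontinuous (f : G -> R[i]) : Prop :=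
  continuous (fun x => complex.Re (f x) : R) /\ continuous (fun x => complex.Im (f x) : R).

Lemma ccontinuous_cst (a : R[i]) : ccontinuous (fun=> a).
Proof. by split => x; exact: cvg_cst. Qed.

Lemma ccontinuousD f g : ccontinuous f -> ccontinuous g -> ccontinuous (fun x => f x + g x).
Proof.
move=> [f1 f2] [g1 g2]; split => x.
  have -> : (fun x => complex.Re (f x + g x)) =
    (fun x => complex.Re (f x) + complex.Re (g x)).
    by apply/funext => y; case: (f y); case: (g y).
  by apply: cvgD; [exact: f1|exact: g1].
have -> : (fun x => complex.Im (f x + g x)) =
  (fun x => complex.Im (f x) + complex.Im (g x)).
  by apply/funext => y; case: (f y); case: (g y).
by apply: cvgD; [exact: f2|exact: g2].
Qed.

Lemma ccontinuousM f g : ccontinuous f -> ccontinuous g -> ccontinuous (fun x => f x * g x).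
Proof.
move=> [f1 f2] [g1 g2]; split => x.
  have -> : (fun x => complex.Re (f x * g x)) =
    (fun x => complex.Re (f x) * complex.Re (g x) - complex.Im (f x) * complex.Im (g x)).
    by apply/funext => y; case: (f y); case: (g y).
  by apply: cvgB; apply: cvgM; [exact: f1|exact: g1|exact: f2|exact: g2].
have -> : (fun x => complex.Im (f x * g x)) =
    (fun x => complex.Re (f x) * complex.Im (g x) + complex.Im (f x) * complex.Re (g x)).
  by apply/funext => y; case: (f y); case: (g y).
by apply: cvgD; apply: cvgM; [exact: f1|exact: g2|exact: f2|exact: g1].
Qed.

Lemma ccontinuous_sum (I : Type) (r : seq I) (F : I -> G -> R[i]) :
  (forall i, ccontinuous (F i)) -> ccontinuous (fun x => \sum_(i <- r) F i x).
Proof.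
move=> H; elim: r => [|i r IH].
  by under eq_fun do rewrite big_nil; exact: ccontinuous_cst.
by under eq_fun do rewrite big_cons; exact: ccontinuousD.
Qed.

Lemma ccontinuous_comp (f : G -> R[i]) (h : G -> G) :
  ccontinuous f -> continuous h -> ccontinuous (fun x => f (h x)).
Proof.
move=> [f1 f2] ch; split => x.
  by apply: (@continuous_comp _ _ _ h (fun y => complex.Re (f y) : R)); [exact: ch|exact: f1].
by apply: (@continuous_comp _ _ _ h (fun y => complex.Im (f y) : R)); [exact: ch|exact: f2].
Qed.

Lemma rigid_complex K (f : G -> R[i]) : rigid K -> ccontinuous f ->
  (exists s : seq R[i], forall x, K x -> f x \in s) -> forall x, K x -> f x = f 1%g.
Proof.
move=> rK [f1 f2] [s fs] x Kx.
have h1 := rK _ f1 _ x Kx; have h2 := rK _ f2 _ x Kx.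
move: h1 h2; case: (f x) (f 1%g) => a b [c d] /= h1 h2.
rewrite h1 ?h2 //.
  by exists (map (@complex.Im R) s) => y /fs; exact: map_f.
by exists (map (@complex.Re R) s) => y /fs; exact: map_f.
Qed.

Lemma ccontinuous_mulmx m n p (A : G -> 'M[R[i]]_(m, n)) (B : G -> 'M[R[i]]_(n, p)) :
  (forall i j, ccontinuous (fun g => A g i j)) ->
  (forall i j, ccontinuous (fun g => B g i j)) ->
  forall i j, ccontinuous (fun g => (A g *m B g) i j).
Proof.
move=> cA cB i j; under eq_fun do rewrite mxE.
by apply: ccontinuous_sum => k; exact: ccontinuousM.
Qed.

End Rigid.

(** A row space of maximal rank among those contained in [Q] exhausts [Q], since a further vector
    would raise the rank. *)
Lemma subspace_matrix (F : fieldType) m (Q : 'rV[F]_m -> Prop) : Q 0 ->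
  (forall a u v, Q u -> Q v -> Q (a *: u + v)) ->
  exists U : 'M[F]_m, forall v, (v <= U)%MS <-> Q v.
Proof.
move=> Q0 QL.
pose P r := `[< exists2 U : 'M[F]_m, \rank U = r & forall v : 'rV_m, (v <= U)%MS -> Q v >].
have P0 : exists r, P r.
  exists 0%N; apply/asboolP; exists 0; first exact: mxrank0.
  by move=> v; rewrite submx0 => /eqP ->.
have Pm r : P r -> (r <= m)%N by move=> /asboolP[U <- _]; exact: rank_leq_row.
case: (ex_maxnP P0 Pm) => r /asboolP[U Ur UQ] rmax.
exists U => v; split; first exact: UQ.
move=> Qv; case: (boolP (v <= U)%MS) => // nvU.
have : P (\rank (U + v)%MS).
  apply/asboolP; exists (U + v)%MS => // w /sub_addsmxP[[a b] /= ->].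
  rewrite (mx11_scalar b) mul_scalar_mx addrC; apply: QL => //.
  by apply: UQ; exact: submxMl.
move/rmax; rewrite -Ur leqNgt => /negP; case.
apply: rank_ltmx; rewrite ltmxE addsmxSl; apply/negP => H.
by move/negP: nvU; apply; apply: submx_trans H; exact: addsmxSr.
Qed.

(** * Common eigenvectors and transverse subspaces *)

Section LieKolchin.
Variables (R : realType) (G : topologicalGroupType).
Local Notation C := R[i].
Implicit Types (K : set G).

(** Continuity is on all of [G] and multiplicativity only on [K], so restricting to the derived
    subgroup keeps the same map and rigidity still applies to its coefficients. *)
Record representation K m (rho : G -> 'M[C]_m) : Prop := Representation {
  repr_continuous : forall i j, ccontinuous (fun g => rho g i j);
  repr1 : rho 1%g = 1%:M;
  reprM : forall x y, K x -> K y -> rho (x * y)%g = rho x *m rho y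
}.

Definition common_eigenvector K m (rho : G -> 'M[C]_m) : Prop :=
  exists2 v : 'rV[C]_m, v != 0 &
    exists chi : G -> C, forall g, K g -> v *m rho g = chi g *: v.

Lemma representation_sub K K' m (rho : G -> 'M[C]_m) :
  K' `<=` K -> representation K rho -> representation K' rho.
Proof. by move=> KK' [H1 H2 H3]; split => // x y /KK' Kx /KK' Ky; exact: H3. Qed.

Lemma representation_unit K m (rho : G -> 'M[C]_m) g : subgroup K ->
  representation K rho -> K g -> rho g \in unitmx.
Proof.
move=> sK rr Kg.
have : rho g *m rho (g^-1)%g = 1%:M.
  by rewrite -(reprM rr) ?mulgV ?(repr1 rr) //; exact: subgroupV.
by move/mulmx1_unit => [].
Qed.

(** The restriction of [rho] to the row space of [U], written in [row_base U], is a representation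
    of smaller dimension, and its eigenvectors are eigenvectors of [rho]. *)
Lemma eigenvector_of_stable K m (rho : G -> 'M[C]_m) (U : 'M[C]_m) :
  subgroup K -> representation K rho ->
  (forall r (sigma : G -> 'M[C]_r), (0 < r < m)%N -> representation K sigma ->
     common_eigenvector K sigma) ->
  (0 < \rank U < m)%N -> (forall g, K g -> (U *m rho g <= U)%MS) ->
  common_eigenvector K rho.
Proof.
move=> sK rr IH rU stU.
pose B := row_base U; have fB : row_free B := row_base_free U.
pose sigma g := B *m rho g *m pinvmx B.
have stB g : K g -> B *m rho g = sigma g *m B.
  move=> Kg; rewrite /sigma mulmxKpV // (eq_row_base U).
  by apply: submx_trans (stU _ Kg); apply: submxMr; rewrite eq_row_base.
have rs : representation K sigma.
  split.
  - by do 2!apply: ccontinuous_mulmx => //; try exact: (repr_continuous rr);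
      move=> i j; exact: ccontinuous_cst.
  - by rewrite /sigma (repr1 rr) mulmx1 mulmxVp.
  - move=> x y Kx Ky; have E : B *m rho (x * y)%g = sigma x *m sigma y *m B.
      rewrite (reprM rr) // [LHS]mulmxA (stB x) // -[LHS]mulmxA (stB y) //.
      by rewrite mulmxA.
    by rewrite {1}/sigma E mulmxKp.
have [w w0 [chi Hw]] := IH _ sigma rU rs.
exists (w *m B).
  apply: contra w0 => /eqP wB; rewrite -[w]mulmx1 -(mulmxVp fB) mulmxA wB.
  by rewrite mul0mx.
by exists chi => g Kg; rewrite -mulmxA stB // mulmxA Hw // scalemxAl.
Qed.

(** Induction on the dimension: a proper nonzero stable subspace is enough. The candidate is a
    weight space of the derived subgroup. When it is the whole space, the image of [K] turns out to
    be commutative, and an eigenspace of a non-scalar element serves instead; if all elements are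
    scalar, any nonzero vector will do. *)
Lemma common_eigenvector_step K : subgroup K -> rigid R K ->
  (forall m (rho : G -> 'M[C]_m), (0 < m)%N ->
     representation (derived_subgroup K) rho ->
     common_eigenvector (derived_subgroup K) rho) ->
  forall m (rho : G -> 'M[C]_m), (0 < m)%N -> representation K rho ->
    common_eigenvector K rho.
Proof.
move=> sK rK IHK m; have [p] := ubnP m; elim: p m => // p IHp m mp rho m0 rr.
have {}IHp r (sigma : G -> 'M[C]_r) : (0 < r < m)%N -> representation K sigma ->
    common_eigenvector K sigma.
  by move=> /andP[r0 rm]; apply: IHp => //; exact: leq_trans rm mp.
set K' := derived_subgroup K in IHK.
have K'K : K' `<=` K by exact: derived_sub.
have sK' : subgroup K' by exact: subgroup_derived.
have [v v0 [chi0 Hv0]] := IHK _ _ m0 (representation_sub K'K rr).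
have [j vj] : exists j, v 0 j != 0 by exact/rV0Pn.
(* A formula for the character that is continuous on all of [G], whereas [chi0] is controlled on
   [K'] only. *)
pose chi g := (v *m rho g) 0 j / v 0 j.
have cchi : ccontinuous chi.
  apply: ccontinuousM; last exact: ccontinuous_cst.
  apply: ccontinuous_mulmx; last exact: (repr_continuous rr).
  by move=> a b; exact: ccontinuous_cst.
have Hv g : K' g -> v *m rho g = chi g *: v.
  by move=> K'g; rewrite /chi Hv0 // mxE mulfK.
(* For [g] in [K'] the numbers [chi (x * g * x^-1)] are eigenvalues of [rho g], with eigenvector
   [v *m rho x]. They are finitely many, so rigidity of [K] makes them independent of [x]. *)
have chi_conj g h : K' g -> K h -> chi (h * g * h^-1)%g = chi g.
  move=> Kg Kh.
  have := rigid_complex (f := fun x => chi (x * g * x^-1)%g) rK _ _ Kh.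
  rewrite mul1g invg1 mulg1; apply.
    apply: (ccontinuous_comp (h := fun x => (x * g * x^-1)%g)) => //.
    apply: mulg_continuous2; last by apply: invg_continuous_comp => x; exact: cvg_id.
    by apply: mulg_continuous2 => [x|]; [exact: cvg_id|exact: cst_continuous].
  have [s sE] := closed_field_poly_normal (char_poly (rho g)).
  exists s => x Kx.
  have : eigenvalue (rho g) (chi (x * g * x^-1)%g).
    apply/eigenvalueP; exists (v *m rho x); last first.
      apply: contra v0 => /eqP H.
      by rewrite -[v](mulmxK (representation_unit sK rr Kx)) H mul0mx.
    have Kc : K' (x * g * x^-1)%g by exact: derived_conj.
    rewrite -mulmxA -(reprM rr) ?K'K //; last exact: K'K.
    have {1}-> : (x * g = (x * g * x^-1) * x)%g by rewrite mulgVK.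
    rewrite (reprM rr) //; last exact: K'K.
    by rewrite mulmxA (Hv _ Kc) scalemxAl.
  rewrite eigenvalue_root_char sE rootZ ?root_prod_XsubC //.
  by rewrite (monicP (char_poly_monic _)) oner_eq0.
(* The weight space of [chi] for [K'], stable under [K] because [chi] is invariant under
   conjugation. *)
pose Q (u : 'rV[C]_m) := forall g, K' g -> u *m rho g = chi g *: u.
have [U HU] : exists U : 'M[C]_m, forall u : 'rV_m, (u <= U)%MS <-> Q u.
  apply: subspace_matrix; first by move=> g _; rewrite mul0mx scaler0.
  move=> a u w Hu Hw g Kg; rewrite mulmxDl -scalemxAl Hu // Hw //.
  by rewrite scalerDr !scalerA mulrC.
have U0 : (0 < \rank U)%N.
  rewrite lt0n mxrank_eq0; apply: contra v0 => /eqP U0.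
  by have /HU := Hv; rewrite U0 submx0.
have stU g : K g -> (U *m rho g <= U)%MS.
  move=> Kg; apply/row_subP => i; rewrite row_mul; apply/HU => h Kh.
  have Hr : Q (row i U) by apply/HU; exact: row_sub.
  rewrite -mulmxA -(reprM rr) //; last exact: K'K.
  have -> : (g * h = (g * h * g^-1) * g)%g by rewrite mulgVK.
  have Kc : K' (g * h * g^-1)%g by exact: derived_conj.
  rewrite (reprM rr) //; last exact: K'K.
  by rewrite mulmxA (Hr _ Kc) chi_conj // scalemxAl.
have [rUm|rUm] := ltnP (\rank U) m.
  by apply: (eigenvector_of_stable sK rr IHp _ stU); rewrite U0.
(* Now the weight space is everything and [K'] acts by scalars. Their determinant is 1, since [K']
   is generated by commutators; so they are [m]-th roots of unity, finitely many, and rigidity of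
   [K'] makes them 1. Hence the image of [K] commutes. *)
have fU : row_full U by rewrite /row_full eqn_leq rank_leq_col.
have scal g : K' g -> rho g = (chi g)%:M.
  move=> Kg; apply/row_matrixP => i.
  have /HU/(_ _ Kg) : (row i 1%:M <= U)%MS by exact: submx_full.
  by rewrite -row_mul mul1mx => ->; rewrite -(scalemx1 _ (chi g)) linearZ.
have det1 g : K' g -> \det (rho g) = 1.
  pose L := [set g | K g /\ \det (rho g) = 1].
  have sL : subgroup L.
    split; first by split; [exact: sK.1|rewrite (repr1 rr) det1].
    move=> x y [Kx dx] [Ky dy].
    have Kxy : K (x * y^-1)%g by exact: sK.2.
    split => //; rewrite -[LHS]mulr1 -{1}dy -det_mulmx -(reprM rr) //.
    by rewrite mulgVK.
  suff LL : K' `<=` L by move=> /LL[].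
  move=> x; apply => // _ [a [b [Ka Kb ->]]].
  have Kc : K [~ a, b]%g by exact: subgroup_commg.
  split => //.
  have Kba : K (b * a)%g by exact: subgroupM.
  have : \det (rho (a * b)%g) = \det (rho (b * a * [~ a, b])%g) by rewrite -commgC.
  rewrite (reprM rr Ka Kb) (reprM rr Kba Kc) (reprM rr Kb Ka) !det_mulmx.
  rewrite [\det (rho b) * _]mulrC.
  have nz : \det (rho a) * \det (rho b) != 0.
    by rewrite mulf_neq0 // -unitfE -unitmxE; exact: (representation_unit sK rr).
  by move=> /esym H; apply: (mulfI nz); rewrite H mulr1.
have triv g : K' g -> rho g = 1%:M.
  move=> Kg; rewrite scal //; congr (_%:M).
  have chi1 : chi 1%g = 1 by rewrite /chi (repr1 rr) mulmx1 mulfV.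
  rewrite -chi1; apply: (rigid_complex (rigid_derived sK rK) cchi _ Kg).
  have [s sE] := closed_field_poly_normal ('X^m - 1 : {poly C}).
  exists s => x Kx.
  have : root ('X^m - 1) (chi x).
    rewrite /root !hornerE subr_eq0; apply/eqP.
    by rewrite -(det1 x Kx) scal // det_scalar.
  rewrite sE rootZ ?root_prod_XsubC //.
  by rewrite lead_coefDl ?lead_coefXn ?oner_eq0 // size_polyXn size_polyN size_poly1.
have comm x y : K x -> K y -> rho x *m rho y = rho y *m rho x.
  move=> Kx Ky; have Kyx : K (y * x)%g by exact: subgroupM.
  have Kc : K' [~ x, y]%g by exact: derived_commg.
  rewrite -(reprM rr Kx Ky) commgC (reprM rr Kyx (K'K _ Kc)) (triv _ Kc) mulmx1.
  exact: (reprM rr Ky Kx).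
have [allscal|] := pselect (forall g, K g -> is_scalar_mx (rho g)).
  exists v => //; exists (fun g => (v *m rho g) 0 j / v 0 j) => g Kg.
  have /is_scalar_mxP[a ->] := allscal _ Kg.
  by rewrite mul_mx_scalar mxE mulfK.
move=> /existsNP[g0 /not_implyP[Kg0 /negP ns]].
have [a ea] : exists a, eigenvalue (rho g0) a.
  have [s sE] := closed_field_poly_normal (char_poly (rho g0)).
  move: sE; rewrite (monicP (char_poly_monic _)) scale1r.
  case: s => [|a s] sE.
    have := size_char_poly (rho g0); rewrite sE big_nil size_poly1 => -[E].
    by exfalso; move: m0; rewrite -E.
  by exists a; rewrite eigenvalue_root_char sE root_prod_XsubC mem_head.
(* The eigenspace is proper because [rho g0] is not scalar, and stable because the image of [K]
   commutes. *)
apply: (@eigenvector_of_stable K m rho (eigenspace (rho g0) a) sK rr IHp).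
  rewrite lt0n mxrank_eq0; apply/andP; split; first exact: ea.
  rewrite ltn_neqAle rank_leq_row andbT.
  apply: contra ns => /eqP rk.
  have fE : row_full (eigenspace (rho g0) a) by rewrite /row_full rk.
  apply/is_scalar_mxP; exists a.
  have /eigenspaceP := submx_full 1%:M fE.
  by rewrite mul1mx => ->; rewrite scalemx1.
move=> g Kg; apply/eigenspaceP.
rewrite -mulmxA (comm g) // mulmxA scalemxAl; congr (_ *m _).
exact/eigenspaceP.
Qed.

Theorem lie_kolchin k K : subgroup K -> rigid R K ->
  iter k (@derived_subgroup G) K = [set 1%g] ->
  forall m (rho : G -> 'M[C]_m), (0 < m)%N -> representation K rho ->
    common_eigenvector K rho.
Proof.
elim: k K => [|k IH] K sK rK.
  move=> /= -> m rho m0 rr.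
  exists (const_mx 1).
    apply/rV0Pn; exists (Ordinal m0); by rewrite mxE oner_eq0.
  by exists (fun=> 1) => _ ->; rewrite (repr1 rr) mulmx1 scale1r.
(* The innermost derived subgroup is peeled off, so the induction hypothesis applies to
   [derived_subgroup K], which inherits rigidity. *)
rewrite iterSr => H; apply: common_eigenvector_step => //.
by apply: IH => //; [exact: subgroup_derived|exact: rigid_derived].
Qed.

(** The rows of the invertible matrix [row_ebase v] form a basis starting with a multiple of [v];
    this puts an eigenvector in first position. *)
Lemma row_ebase_rV m (v : 'rV[C]_m.+1) : v != 0 ->
  exists2 c : C, c != 0 & v = c *: row 0 (row_ebase v).
Proof.
move=> v0; have rv : \rank v = 1%N by rewrite rank_rV v0.
have := mulmx_ebase v; rewrite rv => E.
exists (col_ebase v 0 0).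
  have := col_ebase_unit v; rewrite unitmxE det_mx11 unitfE; exact.
have H : pid_mx 1 *m row_ebase v = row 0 (row_ebase v) :> 'rV[C]_m.+1.
  apply/rowP => j; rewrite !mxE (bigD1 0) //= !mxE eqxx /= mul1r big1 ?addr0 //.
  by case=> [[|k] kk] //= _; rewrite !mxE /= mul0r.
by rewrite -[LHS]E -mulmxA H {1}[col_ebase v]mx11_scalar mul_scalar_mx.
Qed.

Lemma unitmx_lblock m n (A : 'M[C]_m) (B : 'M[C]_(n, m)) (D : 'M[C]_n) :
  A \in unitmx -> D \in unitmx -> block_mx A 0 B D \in unitmx.
Proof. by rewrite !unitmxE det_lblock unitrM => -> ->. Qed.

Lemma row0_usubmx m n (A : 'M[C]_(1 + m, n)) : row 0 A = usubmx A.
Proof. by apply/rowP => j; rewrite !mxE; congr (A _ _); apply/val_inj. Qed.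

(* The [Y]'s are the vectors of a basis adapted to an invariant flag that
   project to a basis of the target of [p]; along the flag, [p] and [rho g] are
   both triangular, hence the determinant of [Y *m rho g *m p] is a product of
   nonzero diagonal entries. *)
Theorem transverse_subspace k K : subgroup K -> rigid R K ->
  iter k (@derived_subgroup G) K = [set 1%g] ->
  forall m n (rho : G -> 'M[C]_m) (p : 'M[C]_(m, n)), representation K rho ->
    row_full p -> exists Y : 'M[C]_(n, m), forall g, K g -> Y *m rho g *m p \in unitmx.
Proof.
move=> sK rK solK; elim=> [|m IH] n rho p rr fp.
  have n0 : n = 0%N by have := rank_leq_row p; rewrite (eqP fp) leqn0 => /eqP.
  rewrite {}n0 in p fp *; exists 0 => g _.
  by rewrite unitmxE det_mx00 unitr1.
have [v v0 [chi Hv]] := lie_kolchin sK rK solK (ltn0Sn m) rr.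
have [c c0 vE] := row_ebase_rV v0.
pose B : 'M[C]_(1 + m) := row_ebase v; have uB : B \in unitmx by exact: row_ebase_unit.
(* The action in a basis starting with the eigenvector: the first row of [sigma g] is [chi g]
   followed by zeros, and its lower right block is the action on the quotient. *)
pose sigma g : 'M[C]_(1 + m) := B *m rho g *m invmx B.
have Bs g : B *m rho g = sigma g *m B by rewrite /sigma mulmxKV.
have sD g : sigma g = B *m rho g *m invmx B by [].
have s1 : sigma 1%g = 1%:M by rewrite sD (repr1 rr) mulmx1 mulmxV.
have cs i j : ccontinuous (fun g => sigma g i j).
  apply: (ccontinuous_mulmx (A := fun g => B *m rho g) (B := fun=> invmx B)).
    apply: (ccontinuous_mulmx (A := fun=> B) (B := rho)).
      by move=> a b; exact: ccontinuous_cst.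
    exact: (repr_continuous rr).
  by move=> a b; exact: ccontinuous_cst.
have sM x y : K x -> K y -> sigma (x * y)%g = sigma x *m sigma y.
  by move=> Kx Ky; rewrite !sD (reprM rr) // !mulmxA mulmxKV.
clearbody sigma.
have row0 : row 0 B = usubmx B by exact: row0_usubmx.
have us g : K g -> ursubmx (sigma g) = 0 /\ ulsubmx (sigma g) = (chi g)%:M.
  move=> Kg.
  have H : row 0 B *m rho g = chi g *: row 0 B.
    apply: (scalerI c0); rewrite scalerA mulrC -scalerA -vE -(Hv _ Kg) vE.
    by rewrite -scalemxAl.
  have H2 : usubmx (sigma g) = chi g *: usubmx (1%:M : 'M[C]_(1 + m)).
    have -> : sigma g = 1%:M *m sigma g by rewrite mul1mx.
    rewrite -[X in usubmx X]/(_ *m _) mul1mx sD -mul_usub_mx -mul_usub_mx -row0 H.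
    by rewrite -scalemxAl row0 mul_usub_mx mulmxV.
  have u1 : usubmx (1%:M : 'M[C]_(1 + m)) = row_mx 1%:M 0.
    by rewrite (@scalar_mx_block _ 1 m 1) block_mxEv col_mxKu.
  by rewrite /ursubmx /ulsubmx H2 u1 scale_row_mx row_mxKl row_mxKr scaler0 scalemx1.
pose sigma1 g := drsubmx (sigma g).
have sE g : K g -> sigma g = block_mx (chi g)%:M 0 (dlsubmx (sigma g)) (sigma1 g).
  by move=> Kg; rewrite -[LHS]submxK; have [-> ->] := us _ Kg.
have rs1 : representation K sigma1.
  split.
  - move=> i j; have -> : (fun g => sigma1 g i j) = (fun g => sigma g (rshift 1 i) (rshift 1 j)).
      by apply/funext => g; rewrite !mxE.
    exact: cs.
  - by rewrite /sigma1 s1 (@scalar_mx_block _ 1 m 1) block_mxKdr.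
  - move=> x y Kx Ky; rewrite {1}/sigma1 (sM _ _ Kx Ky) (sE _ Kx) (sE _ Ky) mulmx_block.
    by rewrite block_mxKdr mulmx0 add0r.
have chi0 g : K g -> chi g != 0.
  move=> Kg; apply: contra v0 => /eqP chi0.
  have := Hv _ Kg; rewrite chi0 scale0r => H.
  by rewrite -[v](mulmxK (representation_unit sK rr Kg)) H mul0mx.
pose q : 'M[C]_(1 + m, n) := B *m p.
have Bp : p = invmx B *m q by rewrite /q mulKmx.
have Bq g r (Z : 'M[C]_(r, 1 + m)) : Z *m B *m rho g *m p = Z *m (sigma g *m q).
  by rewrite -(mulmxA Z) Bs /q !mulmxA.
(* The first row of [q] is, up to a nonzero scalar, the image of the eigenvector under [p]. If it is
   zero, the map factors through the quotient by the eigenvector, and [Y] comes from there. *)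
have [q0|q0] := eqVneq (usubmx q) 0.
  have qE : q = col_mx 0 (dsubmx q) by rewrite -[LHS]vsubmxK q0.
  have fq : row_full (dsubmx q).
    have /row_fullP[D DE] := fp.
    apply/row_fullP; exists (rsubmx (D *m invmx B : 'M[C]_(n, 1 + m))).
    move: DE; rewrite Bp mulmxA {1}qE -[D *m _ in LHS](@hsubmxK _ n 1 m) mul_row_col.
    by rewrite mulmx0 add0r.
  have [Y HY] := IH _ _ _ rs1 fq.
  exists (row_mx 0 Y *m B) => g Kg.
  rewrite Bq (sE _ Kg) {1}qE mul_block_col mul_row_col !mulmx0 !add0r.
  by rewrite !mul0mx add0r mulmxA; exact: HY.
case: n p fp q Bp Bq q0 => [|n] p fp q Bp Bq q0.
  by move: q0; rewrite thinmx0 eqxx.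
(* Otherwise [D] is a basis of the target starting with a multiple of that image. Splitting off both
   lines leaves the quotients to the induction and contributes the diagonal entry [chi g * d]. *)
have [d d0 qE] := row_ebase_rV q0.
pose D : 'M[C]_(1 + n) := row_ebase (usubmx q).
have uD : D \in unitmx by exact: row_ebase_unit.
pose r : 'M[C]_(1 + m, 1 + n) := q *m invmx D.
have ru : usubmx r = d *: row_mx 1%:M 0.
  rewrite /r -mul_usub_mx qE -scalemxAl -row_mul -/D mulmxV //; congr (_ *: _).
  rewrite (@scalar_mx_block _ 1 n 1) block_mxEv.
  by rewrite row0_usubmx col_mxKu.
have rE : r = block_mx d%:M 0 (dlsubmx r) (drsubmx r).
  rewrite -[LHS](@submxK _ 1 m 1 n) /ulsubmx /ursubmx ru scale_row_mx row_mxKl row_mxKr.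
  by rewrite scaler0 scalemx1.
have fr : row_full (drsubmx r).
  have /row_fullP[E EE] := fp.
  have : (D *m E *m invmx B) *m r = 1%:M.
    by rewrite /r mulmxA -(mulmxA _ (invmx B)) -Bp -(mulmxA D) EE mulmx1 mulmxV.
  move: (D *m E *m invmx B) => F; rewrite -[F](@submxK _ 1 n 1 m) {1}rE mulmx_block.
  rewrite (@scalar_mx_block _ 1 n 1) => /eq_block_mx[_ _ _].
  by rewrite mulmx0 add0r => H; apply/row_fullP; exists (drsubmx F).
have [Y HY] := IH _ _ _ rs1 fr.
exists (block_mx 1%:M 0 0 Y *m B) => g Kg.
rewrite Bq -[q](mulmxKV uD) -/r mulmxA mulmxA.
have E : block_mx 1%:M 0 0 Y *m sigma g *m r = block_mx (chi g * d)%:M 0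
    (Y *m dlsubmx (sigma g) *m d%:M + Y *m sigma1 g *m dlsubmx r)
    (Y *m sigma1 g *m drsubmx r) :> 'M[C]_(1 + n).
  rewrite (sE _ Kg) {1}rE !mulmx_block !(mul0mx, mulmx0, addr0, add0r, mul1mx).
  by rewrite -scalar_mxM block_mxKdl.
have uE : block_mx 1%:M 0 0 Y *m sigma g *m r \in unitmx.
  rewrite E; apply: unitmx_lblock; last exact: HY.
  by rewrite unitmxE det_scalar1 unitfE mulf_neq0 // chi0.
by rewrite unitmx_mul uD andbT; exact: uE.
Qed.

End LieKolchin.

(** * Complex-valued functions *)

Section RealRules.
Variables (R : realType) (V : normedModType R).
Implicit Types (f g : V -> R^o) (x v : V).

Lemma smooth_deriveD f g x v : smooth_at f x -> smooth_at g x ->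
  'D_v (fun y => f y + g y : R^o) x = 'D_v f x + 'D_v g x.
Proof. by move=> sf sg; apply: deriveD; exact: smooth_at_derivable. Qed.

Lemma smooth_deriveM f g x v : smooth_at f x -> smooth_at g x ->
  'D_v (fun y => f y * g y : R^o) x = f x * 'D_v g x + g x * 'D_v f x.
Proof. by move=> sf sg; apply: (@deriveM _ _ f g); exact: smooth_at_derivable. Qed.

Lemma smooth_deriveN f x v : smooth_at f x ->
  'D_v (fun y => - f y : R^o) x = - 'D_v f x.
Proof. by move=> sf; apply: deriveN; exact: smooth_at_derivable. Qed.

End RealRules.

Section ComplexSmooth.
Variables (R : realType).
Implicit Types V W : normedModType R.
Local Notation C := R[i].

Definition csmooth_at V (f : V -> C) (x : V) : Prop :=
  smooth_at (realpart f) x /\ smooth_at (imagpart f) x.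

Lemma csmooth_at_on V (U : set V) (f : V -> C) :
  (forall x, U x -> csmooth_at f x) -> csmooth_on U f.
Proof. by move=> H; split; apply: smooth_at_on => x /H []. Qed.

Lemma csmooth_at_ext V (f g : V -> C) x :
  {near x, f =1 g} -> csmooth_at f x -> csmooth_at g x.
Proof.
by move=> fg [f1 f2]; split; [move: f1|move: f2]; apply: smooth_at_ext;
  apply: filterS fg => y; rewrite /realpart /imagpart => ->.
Qed.

Lemma cderive_ext V (f g : V -> C) x v :
  {near x, f =1 g} -> cderive v f x = cderive v g x.
Proof.
by move=> fg; congr Complex; apply: near_eq_derive;
  apply: filterS fg => y; rewrite /realpart /imagpart => ->.
Qed.

Lemma csmooth_at_cst V (a : C) (x : V) : csmooth_at (fun=> a) x.
Proof. by split; exact: smooth_at_cst. Qed.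

Lemma cderive_cst V (a : C) (x v : V) : cderive v (fun=> a) x = 0.
Proof. by rewrite /cderive; congr Complex; exact: derive_cst. Qed.

Lemma csmooth_atD V (f g : V -> C) x :
  csmooth_at f x -> csmooth_at g x -> csmooth_at (fun y => f y + g y) x.
Proof.
move=> [f1 f2] [g1 g2]; split.
  have -> : realpart (fun y => f y + g y) = (fun y => realpart f y + realpart g y).
    by apply/funext => y; rewrite /realpart; case: (f y); case: (g y).
  exact: smooth_at_add.
have -> : imagpart (fun y => f y + g y) = (fun y => imagpart f y + imagpart g y).
  by apply/funext => y; rewrite /imagpart; case: (f y); case: (g y).
exact: smooth_at_add.
Qed.

Lemma cderiveD V (f g : V -> C) x v : csmooth_at f x -> csmooth_at g x ->
  cderive v (fun y => f y + g y) x = cderive v f x + cderive v g x.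
Proof.
move=> [f1 f2] [g1 g2]; rewrite /cderive.
have -> : realpart (fun y => f y + g y) = (fun y => realpart f y + realpart g y).
  by apply/funext => y; rewrite /realpart; case: (f y); case: (g y).
have -> : imagpart (fun y => f y + g y) = (fun y => imagpart f y + imagpart g y).
  by apply/funext => y; rewrite /imagpart; case: (f y); case: (g y).
by rewrite !smooth_deriveD.
Qed.

Lemma realpartM V (f g : V -> C) : realpart (fun y => f y * g y) =
  (fun y => realpart f y * realpart g y + - (imagpart f y * imagpart g y)).
Proof.
by apply/funext => y; rewrite /realpart /imagpart; case: (f y); case: (g y).
Qed.

Lemma imagpartM V (f g : V -> C) : imagpart (fun y => f y * g y) =
  (fun y => realpart f y * imagpart g y + imagpart f y * realpart g y).
Proof.
by apply/funext => y; rewrite /realpart /imagpart; case: (f y); case: (g y).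
Qed.

Lemma csmooth_atM V (f g : V -> C) x :
  csmooth_at f x -> csmooth_at g x -> csmooth_at (fun y => f y * g y) x.
Proof.
move=> [f1 f2] [g1 g2]; split.
  rewrite realpartM; apply: smooth_at_add; first exact: smooth_at_mul.
  by apply: smooth_at_opp; exact: smooth_at_mul.
by rewrite imagpartM; apply: smooth_at_add; exact: smooth_at_mul.
Qed.

Lemma cderiveM V (f g : V -> C) x v : csmooth_at f x -> csmooth_at g x ->
  cderive v (fun y => f y * g y) x = f x * cderive v g x + g x * cderive v f x.
Proof.
move=> [f1 f2] [g1 g2]; rewrite /cderive realpartM imagpartM.
rewrite smooth_deriveD; last 2 first.
- exact: smooth_at_mul.
- by apply: smooth_at_opp; exact: smooth_at_mul.
rewrite smooth_deriveN; last exact: smooth_at_mul.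
rewrite smooth_deriveD; [|exact: smooth_at_mul|exact: smooth_at_mul].
rewrite !smooth_deriveM //.
have [fE gE] : f x = Complex (realpart f x) (imagpart f x) /\
    g x = Complex (realpart g x) (imagpart g x).
  by rewrite /realpart /imagpart; split; [case: (f x)|case: (g x)].
rewrite fE gE.
move: (realpart f x) (imagpart f x) (realpart g x) (imagpart g x).
move: ('D_v (realpart f) x) ('D_v (imagpart f) x) ('D_v (realpart g) x) ('D_v (imagpart g) x).
move=> a b c d e f' g' h; apply/eqP; rewrite eq_complex /=; apply/andP; split; apply/eqP.
  by rewrite opprD addrACA.
by rewrite -!addrA; congr (_ + _); rewrite addrC -addrA.
Qed.

(** The inverse is the conjugate divided by the squared modulus [N]. *)
Lemma csmooth_at_inv V (f : V -> C) x : f x != 0 ->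
  csmooth_at f x -> csmooth_at (fun y => (f y)^-1) x.
Proof.
move=> fx0 [f1 f2].
pose N y : R^o := realpart f y * realpart f y + imagpart f y * imagpart f y.
have N0 : N x != 0.
  apply: contra fx0; rewrite /N /realpart /imagpart; case: (f x) => a b /=.
  rewrite paddr_eq0 -?expr2 ?sqr_ge0 // !sqrf_eq0 => /andP[/eqP -> /eqP ->].
  by rewrite eqxx.
have sN : smooth_at (fun y => (N y)^-1 : R^o) x.
  by apply: smooth_at_inv => //; apply: smooth_at_add; exact: smooth_at_mul.
split.
  have -> : realpart (fun y => (f y)^-1) = (fun y => realpart f y * (N y)^-1).
    by apply/funext => y; rewrite /realpart /N /imagpart /realpart; case: (f y).
  exact: smooth_at_mul.
have -> : imagpart (fun y => (f y)^-1) = (fun y => - (imagpart f y * (N y)^-1)).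
  by apply/funext => y; rewrite /imagpart /N /realpart /imagpart; case: (f y) => a b /=;
     rewrite ?mulNr.
by apply: smooth_at_opp; exact: smooth_at_mul.
Qed.

Lemma csmooth_at_neq0 V (f : V -> C) x : f x != 0 -> csmooth_at f x ->
  \forall y \near x, f y != 0.
Proof.
move=> fx0 [/smooth_at_continuous f1 /smooth_at_continuous f2].
have [r0|i0] : realpart f x != 0 \/ imagpart f x != 0.
  move: fx0; rewrite /realpart /imagpart; case: (f x) => a b /=.
  by rewrite eq_complex /= negb_and => /orP.
- have nr : \forall y \near x, realpart f y != 0.
    exact: (f1 _ (open_nbhs_nbhs (conj (@open_neq R 0) r0))).
  by apply: filterS nr => y /=; apply: contra => /eqP; rewrite /realpart => ->.
- have ni : \forall y \near x, imagpart f y != 0.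
    exact: (f2 _ (open_nbhs_nbhs (conj (@open_neq R 0) i0))).
  by apply: filterS ni => y /=; apply: contra => /eqP; rewrite /imagpart => ->.
Qed.

Lemma csmooth_at_sum V (I : Type) (r : seq I) (F : I -> V -> C) x :
  (forall i, csmooth_at (F i) x) -> csmooth_at (fun y => \sum_(i <- r) F i y) x.
Proof.
move=> H; elim: r => [|i r IH].
  by under eq_fun do rewrite big_nil; exact: csmooth_at_cst.
by under eq_fun do rewrite big_cons; exact: csmooth_atD.
Qed.

Lemma cderive_sum V (I : Type) (r : seq I) (F : I -> V -> C) x v :
  (forall i, csmooth_at (F i) x) ->
  cderive v (fun y => \sum_(i <- r) F i y) x = \sum_(i <- r) cderive v (F i) x.
Proof.
move=> H; elim: r => [|i r IH].
  by under eq_fun do rewrite big_nil; rewrite big_nil cderive_cst.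
under eq_fun do rewrite big_cons; rewrite big_cons -IH cderiveD //.
exact: csmooth_at_sum.
Qed.

Lemma csmooth_at_prod V (I : Type) (r : seq I) (F : I -> V -> C) x :
  (forall i, csmooth_at (F i) x) -> csmooth_at (fun y => \prod_(i <- r) F i y) x.
Proof.
move=> H; elim: r => [|i r IH].
  by under eq_fun do rewrite big_nil; exact: csmooth_at_cst.
by under eq_fun do rewrite big_cons; exact: csmooth_atM.
Qed.

(** Distinct indices let the test [j == i] single out the one differentiated factor. *)
Lemma cderive_prod V (I : eqType) (r : seq I) (F : I -> V -> C) x v : uniq r ->
  (forall i, csmooth_at (F i) x) ->
  cderive v (fun y => \prod_(i <- r) F i y) x =
  \sum_(i <- r) \prod_(j <- r) (if j == i then cderive v (F j) x else F j x).
Proof.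
move=> + H; elim: r => [|i r IH] /=.
  by under eq_fun do rewrite big_nil; rewrite big_nil cderive_cst.
move=> /andP[ir ur].
under eq_fun do rewrite big_cons; rewrite big_cons cderiveM //; last exact: csmooth_at_prod.
rewrite IH // addrC mulr_sumr; congr (_ + _).
  rewrite big_cons eqxx mulrC; congr (_ * _).
  by apply: eq_big_seq => j jr; case: eqP => // ji; move: ir; rewrite -ji jr.
apply: eq_big_seq => j jr; rewrite big_cons.
by case: eqP => // ij; move: ir; rewrite ij jr.
Qed.

Lemma csmooth_at_det V n (M : V -> 'M[C]_n) x :
  (forall i j, csmooth_at (fun y => M y i j) x) -> csmooth_at (fun y => \det (M y)) x.
Proof.
move=> H; apply: csmooth_at_sum => s; apply: csmooth_atM; first exact: csmooth_at_cst.
by apply: csmooth_at_prod => i; exact: H.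
Qed.

(** Each product in the expansion has one factor per row, so the product rule differentiates one row
    at a time. *)
Lemma cderive_det V n (M : V -> 'M[C]_n) x v :
  (forall i j, csmooth_at (fun y => M y i j) x) ->
  cderive v (fun y => \det (M y)) x =
  \sum_(k < n) \det (\matrix_(i, j)
    (if i == k then cderive v (fun y => M y i j) x else M x i j)).
Proof.
move=> H; rewrite cderive_sum => [|s]; last first.
  apply: csmooth_atM; first exact: csmooth_at_cst.
  by apply: csmooth_at_prod => i; exact: H.
rewrite exchange_big; apply: eq_bigr => s _ /=.
rewrite cderiveM; [|exact: csmooth_at_cst|by apply: csmooth_at_prod => i; exact: H].
rewrite cderive_cst mulr0 addr0 cderive_prod ?index_enum_uniq // mulr_sumr.
apply: eq_bigr => k _; congr (_ * _); apply: eq_bigr => i _; by rewrite mxE.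
Qed.

Lemma csmooth_at_comp V W {fW : fin_dim W} (g : V -> W) (f : W -> C) x :
  smooth_at g x -> csmooth_at f (g x) -> csmooth_at (fun y => f (g y)) x.
Proof.
move=> sg [f1 f2]; split.
  exact: (smooth_at_comp (f := realpart f)).
exact: (smooth_at_comp (f := imagpart f)).
Qed.

Lemma cderive_comp V W {fW : fin_dim W} (g : V -> W) (f : W -> C) x v :
  smooth_at g x -> csmooth_at f (g x) ->
  cderive v (fun y => f (g y)) x = cderive ('D_v g x) f (g x).
Proof.
move=> sg [f1 f2]; rewrite /cderive; congr Complex.
  apply: (derive_comp (f := realpart f)); first exact: smooth_at_derivable.
  exact: smooth_at_differentiable.
apply: (derive_comp (f := imagpart f)); first exact: smooth_at_derivable.
exact: smooth_at_differentiable.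
Qed.

Lemma cderive_linear V {fV : fin_dim V} (f : V -> C) x (c : R) u v :
  csmooth_at f x ->
  cderive (c *: u + v) f x = c%:C%C * cderive u f x + cderive v f x.
Proof.
move=> [f1 f2]; rewrite /cderive !deriveDv ?deriveZv;
  try exact: smooth_at_differentiable.
by apply/eqP; rewrite eq_complex /= !mul0r subr0 addr0 !eqxx.
Qed.

Lemma cderive_inv V (f : V -> C) x v : f x != 0 -> csmooth_at f x ->
  cderive v (fun y => (f y)^-1) x = - (f x)^-1 ^+ 2 * cderive v f x.
Proof.
move=> fx0 sf; have sV := csmooth_at_inv fx0 sf.
have : cderive v (fun y => f y * (f y)^-1) x = 0.
  rewrite -(cderive_cst 1 x v); apply: cderive_ext.
  by apply: filterS (csmooth_at_neq0 fx0 sf) => y fy0; rewrite mulfV.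
rewrite cderiveM // => /eqP; rewrite addr_eq0 => /eqP H.
by apply: (mulfI fx0); rewrite H expr2 !mulNr mulrN -!mulrA mulVKf.
Qed.

End ComplexSmooth.

(** * Complex vectors and exterior derivatives *)

Section DetLemmas.
Variable F : numFieldType.
Variable n : nat.
Implicit Types (b : 'I_n.+1 -> 'rV[F]_n) (c : 'I_n.+1 -> F).

(** With [c i] the value of dh and [b i] the values of the dz_k on the [i]-th vector, the
    determinant is the value of the wedge of dh with dz_1 ... dz_n. *)
Definition bordered c b : 'M[F]_n.+1 :=
  \matrix_(i, k) if unlift ord0 k is Some k' then b i 0 k' else c i.

Lemma det_bordered c b : \det (bordered c b) =
  \sum_(i < n.+1) (-1) ^+ i * (c i * \det (\matrix_(j < n, k < n) b (lift i j) 0 k)).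
Proof.
rewrite (expand_det_col _ ord0); apply: eq_bigr => i _.
rewrite mxE unlift_none /cofactor addn0 mulrCA; congr (_ * (_ * _)).
by congr (\det _); apply/matrixP => j k; rewrite !mxE liftK.
Qed.

(** The border column is the combination of the others with coefficients [h], so the vector with
    entries -1 and [h] lies in the kernel. In terms of forms, dh is a combination of the dz_k. *)
Lemma det_bordered_dep c b (h : 'I_n -> F) :
  (forall i, c i = \sum_k b i 0 k * h k) -> \det (bordered c b) = 0.
Proof.
move=> ch; apply/eqP; rewrite -[_ == 0]negbK -unitfE -unitmxE; apply/negP => uM.
pose z : 'cV[F]_n.+1 := \col_k (if unlift ord0 k is Some k' then h k' else -1).
have Mz : bordered c b *m z = 0.
  apply/colP => i; rewrite !mxE big_ord_recl !mxE unlift_none mulrN1.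
  rewrite (eq_bigr (fun k => b i 0 k * h k)) => [|k _]; last by rewrite !mxE liftK.
  by rewrite -ch addNr.
have : z = 0 by rewrite -[z](mulKmx uM) Mz mulmx0.
move=> /colP/(_ ord0); rewrite !mxE unlift_none => /eqP.
by rewrite oppr_eq0 oner_eq0.
Qed.

(* Bordering by the [i]-th unit column turns the [(i, i')] term into a single
   determinant of size [n.+1], antisymmetric in [i] and [i']. *)
Lemma det_sym_cancel b (H : 'I_n.+1 -> 'I_n.+1 -> 'rV[F]_n) :
  (forall i i', H i i' = H i' i) ->
  \sum_(i < n.+1) (-1) ^+ i * \sum_(j' < n) \det (\matrix_(j < n, k < n)
     (if j == j' then H i (lift i j') 0 k else b (lift i j) 0 k)) = 0.
Proof.
move=> symH.
(* Row [i] is emptied except for the unit entry of the border, and row [i'] carries the second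
   derivative; exchanging [i] and [i'] then swaps two rows because [H] is symmetric. *)
pose bb i i' l : 'rV[F]_n :=
  if l == i then 0 else if l == i' then H i i' else b l.
pose T i i' := if i == i' then 0 else \det (bordered (fun l => (l == i)%:R) (bb i i')).
have TE (i : 'I_n.+1) : (-1) ^+ i * \sum_(j' < n) \det (\matrix_(j < n, k < n)
     (if j == j' then H i (lift i j') 0 k else b (lift i j) 0 k)) = \sum_i' T i i'.
  rewrite (bigD1_ord i) //= /T eqxx add0r mulr_sumr; apply: eq_bigr => j' _.
  rewrite (negPf (neq_lift i j')) det_bordered (bigD1 i) //= big1 => [|l /negPf li].
    rewrite addr0 eqxx mul1r; congr (_ * \det _); apply/matrixP => j k; rewrite !mxE.
    rewrite /bb [lift i j == i]eq_sym (negPf (neq_lift i j)) (inj_eq (@lift_inj _ i)).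
    by case: eqP.
  by rewrite li mul0r mulr0.
have anti i i' : T i i' = - T i' i.
  rewrite /T eq_sym; case: eqVneq => [|ii']; first by rewrite oppr0.
  have -> : bordered (fun l => (l == i')%:R) (bb i' i) =
      perm_mx (tperm i i') *m bordered (fun l => (l == i)%:R) (bb i i').
    rewrite -row_permE; apply/matrixP => l k; rewrite !mxE.
    case: unliftP => [k' _|_].
      rewrite /bb; case: tpermP => [->|->|/eqP/negPf li /eqP/negPf li'].
      - by rewrite !eqxx [i == i']eq_sym (negPf ii') symH.
      - by rewrite !eqxx.
      - by rewrite li li'.
    case: tpermP => [->|->|/eqP/negPf li /eqP/negPf li'].
    - by rewrite [i == i']eq_sym (negPf ii').
    - by rewrite !eqxx.
    - by rewrite li li'.
  rewrite det_mulmx det_perm odd_tperm [i == i']eq_sym ii' /= expr1 mulN1r opprK.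
  by [].
under eq_bigr do rewrite TE.
set S := \sum_i _.
have SN : S = - S.
  by rewrite {1}/S exchange_big /= -sumrN; apply: eq_bigr => i _; rewrite -sumrN;
     apply: eq_bigr => i' _; exact: anti.
have : S *+ 2 == 0 by rewrite mulr2n {1}SN addNr.
by rewrite mulrn_eq0 => /eqP.
Qed.

End DetLemmas.

Section ComplexVectors.
Variables (R : realType) (n : nat).
Local Notation C := R[i].
Implicit Types v w : 'rV[R]_(n + n).

Definition cvec v : 'rV[C]_n := \row_k Complex (v 0 (lshift n k)) (v 0 (rshift n k)).

Definition rvec (z : 'rV[C]_n) : 'rV[R]_(n + n) :=
  row_mx (\row_k complex.Re (z 0 k)) (\row_k complex.Im (z 0 k)).

Definition cbasis (k : 'I_n) : 'rV[R]_(n + n) := delta_mx 0 (lshift n k).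

Lemma rvecK z : cvec (rvec z) = z.
Proof. by apply/rowP => k; rewrite mxE /rvec row_mxEl row_mxEr !mxE; case: (z 0 k). Qed.

Lemma cvec_linear (c : R) u v : cvec (c *: u + v) = c%:C%C *: cvec u + cvec v.
Proof.
apply/rowP => k; rewrite !mxE; apply/eqP; rewrite eq_complex /=.
by rewrite !mul0r subr0 addr0 !eqxx.
Qed.

Lemma cvec_mulJ v : cvec (mulJ v) = 'i%C *: cvec v.
Proof.
apply/rowP => k; rewrite mxE [RHS]mxE /mulJ row_mxEl row_mxEr !mxE.
by apply/eqP; rewrite eq_complex /= !mul0r !mul1r sub0r add0r !eqxx.
Qed.

Lemma mulJ_cbasis k : mulJ (cbasis k) = delta_mx 0 (rshift n k).
Proof.
apply/rowP => j; rewrite /mulJ /cbasis; case: (split_ordP j) => l ->.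
  by rewrite row_mxEl !mxE /= eq_lrshift eq_rlshift oppr0.
by rewrite row_mxEr !mxE /= (inj_eq (@lshift_inj _ _)) (inj_eq (@rshift_inj _ _)).
Qed.

(** The coordinate vectors d/dy_k are [mulJ] of the vectors [cbasis k], which are the d/dx_k, so a
    complex linear functional is determined by the latter. *)
Lemma clinear_cbasis (phi : 'rV[R]_(n + n) -> C) :
  (forall (c : R) u v, phi (c *: u + v) = c%:C%C * phi u + phi v) ->
  (forall v, phi (mulJ v) = 'i%C * phi v) ->
  forall v, phi v = \sum_k cvec v 0 k * phi (cbasis k).
Proof.
move=> phiL phiJ v.
have phi0 : phi 0 = 0.
  by have := phiL (-1) 0 0; rewrite scaler0 addr0 rmorphN rmorph1 mulN1r addNr.
have phiS (I : Type) (r : seq I) (c : I -> R) u :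
    phi (\sum_(i <- r) c i *: u i) = \sum_(i <- r) (c i)%:C%C * phi (u i).
  by elim: r => [|i r IH]; rewrite ?big_nil // !big_cons phiL IH.
rewrite [in LHS](row_sum_delta v) phiS big_split_ord /= -big_split /=.
apply: eq_bigr => k _; rewrite -mulJ_cbasis phiJ -/(cbasis k) mulrA -mulrDl.
congr (_ * _); rewrite mxE; apply/eqP; rewrite eq_complex /=.
by rewrite !mulr0 !mulr1 subr0 !addr0 !add0r !eqxx.
Qed.

Lemma csmooth_at_cvec (V : normedModType R) (T : V -> 'rV[R]_(n + n)) x k :
  smooth_at T x -> csmooth_at (fun y => cvec (T y) 0 k) x.
Proof.
move=> sT; split.
  have -> : realpart (fun y => cvec (T y) 0 k) = (fun y => T y 0 (lshift n k)).
    by apply/funext => y; rewrite /realpart mxE.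
  exact: smooth_at_coord.
have -> : imagpart (fun y => cvec (T y) 0 k) = (fun y => T y 0 (rshift n k)).
  by apply/funext => y; rewrite /imagpart mxE.
exact: smooth_at_coord.
Qed.

Lemma cderive_cvec (V : normedModType R) (T : V -> 'rV[R]_(n + n)) x (v : V) k :
  smooth_at T x -> cderive v (fun y => cvec (T y) 0 k) x = cvec ('D_v T x) 0 k.
Proof.
move=> sT; rewrite [RHS]mxE /cderive; congr Complex.
  have -> : realpart (fun y => cvec (T y) 0 k) = (fun y => T y 0 (lshift n k)).
    by apply/funext => y; rewrite /realpart mxE.
  by apply: derive_coord; exact: smooth_at_derivable.
have -> : imagpart (fun y => cvec (T y) 0 k) = (fun y => T y 0 (rshift n k)).
  by apply/funext => y; rewrite /imagpart mxE.
by apply: derive_coord; exact: smooth_at_derivable.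
Qed.

(** The matrix of the dz_k on the vectors [v j]; its determinant is the value of dz_1 ... dz_n. *)
Definition frame_mx (v : 'I_n -> 'rV[R]_(n + n)) : 'M[C]_n := \matrix_j cvec (v j).

(** The form is the pullback by [T] of h dz_1 ... dz_n. Differentiating the determinant produces
    second derivatives of [T], cancelled by [det_sym_cancel]; differentiating [h] produces the
    bordered determinant, zero because the Cauchy-Riemann equations make dh a combination of the
    dz_k at [T x]. [T] itself is merely smooth. *)
Lemma exterior_derivative_pullback m (T : 'rV[R]_m -> 'rV[R]_(n + n))
    (h : 'rV[R]_(n + n) -> C) x (v : 'I_n.+1 -> 'rV[R]_m) :
  smooth_at T x -> csmooth_at h (T x) ->
  (forall u, cderive (mulJ u) h (T x) = 'i%C * cderive u h (T x)) ->
  exterior_derivative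
    (fun y (u : 'I_n -> 'rV[R]_m) => h (T y) * \det (frame_mx (fun j => 'D_(u j) T y))) x v = 0.
Proof.
move=> sT sh hJ; rewrite /exterior_derivative.
pose b i := cvec ('D_(v i) T x).
pose H i i' := cvec ('D_(v i) ('D_(v i') T) x).
have symH i i' : H i i' = H i' i.
  exact: (congr1 cvec (derive_sym_rV (v i) (v i') sT)).
pose c i := cderive ('D_(v i) T x) h (T x).
have cE i : c i = \sum_k b i 0 k * cderive (cbasis k) h (T x).
  apply: (@clinear_cbasis (fun u => cderive u h (T x))) => // a u w.
  exact: cderive_linear.
have entry (u : 'I_n -> 'rV[R]_m) (j k : 'I_n) :
    csmooth_at (fun y => frame_mx (fun j => 'D_(u j) T y) j k) x.
  have -> : (fun y => frame_mx (fun j => 'D_(u j) T y) j k) =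
            (fun y => cvec ('D_(u j) T y) 0 k).
    by apply/funext => y; rewrite !mxE.
  by apply: csmooth_at_cvec; exact: smooth_at_derive.
have term i : cderive (v i) (fun y => h (T y) *
      \det (frame_mx (fun j => 'D_(v (lift i j)) T y))) x =
    h (T x) * \sum_(j' < n) \det (\matrix_(j < n, k < n)
     (if j == j' then H i (lift i j') 0 k else b (lift i j) 0 k)) +
    c i * \det (\matrix_(j < n, k < n) b (lift i j) 0 k).
  rewrite cderiveM; last 2 first.
  - exact: csmooth_at_comp.
  - by apply: csmooth_at_det => j k; exact: (entry (fun j => v (lift i j))).
  congr (_ + _); last first.
    rewrite mulrC cderive_comp // /c; congr (_ * _); congr (\det _).
  rewrite cderive_det; last by move=> j k; exact: (entry (fun j => v (lift i j))).
  congr (_ * _); apply: eq_bigr => j' _; congr (\det _); apply/matrixP => j k.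
  rewrite [LHS]mxE [RHS]mxE; case: eqP => [->|_]; last by rewrite mxE.
  have -> : (fun y => frame_mx (fun j => 'D_(v (lift i j)) T y) j' k) =
            (fun y => cvec ('D_(v (lift i j')) T y) 0 k).
    by apply/funext => y; rewrite mxE.
  by apply: cderive_cvec; exact: smooth_at_derive.
under eq_bigr do rewrite term mulrDr mulrCA.
rewrite big_split /= -mulr_sumr det_sym_cancel // mulr0 add0r.
by rewrite -det_bordered; exact: det_bordered_dep cE.
Qed.

End ComplexVectors.

(** * Smooth maps into a Lie group *)

Lemma smooth_on_near (R : realType) (V W : normedModType R) (U : set V)
    (f : V -> W) x :
  smooth_on U f -> (\forall y \near x, U y) -> smooth_at f x.
Proof.
move=> sf /near_open[B [oB Bx] BU]; exists B => // k.
exact: Ck_subset BU (sf k).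
Qed.

Section PartialDerivatives.
Variables (R : realType) (V W Z : normedModType R) (F : V * W -> Z).

Lemma derive_partial1 u z w :
  'D_u (fun z' => F (z', w)) z = 'D_(u, 0) F (z, w).
Proof.
have E : (fun h : R => h^-1 *: (F (h *: u + z, w) - F (z, w))) =
    (fun h => h^-1 *: (F (h *: (u, 0) + (z, w)) - F (z, w))).
  apply/funext => h; congr (_ *: (F _ - _)).
  by rewrite -[RHS]/(h *: u + z, h *: 0 + w) scaler0 add0r.
by rewrite /derive /= E.
Qed.

Lemma derive_partial2 u z w :
  'D_u (fun w' => F (z, w')) w = 'D_(0, u) F (z, w).
Proof.
have E : (fun h : R => h^-1 *: (F (z, h *: u + w) - F (z, w))) =
    (fun h => h^-1 *: (F (h *: (0, u) + (z, w)) - F (z, w))).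
  apply/funext => h; congr (_ *: (F _ - _)).
  by rewrite -[RHS]/(h *: 0 + z, h *: u + w) scaler0 add0r.
by rewrite /derive /= E.
Qed.

End PartialDerivatives.

Lemma derive_partial_sym (R : realType) (V W : normedModType R) m
    (F : V * W -> 'rV[R]_m) u v z w : smooth_at F (z, w) ->
  'D_v (fun y => 'D_(u, 0) F (z, y)) w = 'D_(u, 0) ('D_(0, v) F) (z, w).
Proof.
by move=> sF; rewrite (derive_partial2 ('D_(u, 0) F)); exact: derive_sym_rV.
Qed.

Section ChartTopology.
Variables (R : realType) (M : topologicalType) (m : nat).
Implicit Types (phi psi : chart R M m).

Lemma near_chart_dom phi p : chart_dom phi p -> \forall q \near p, chart_dom phi q.
Proof. by move=> dp; apply: open_nbhs_nbhs; split => //; exact: chart_open_dom. Qed.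

Lemma near_chart_cod phi x : chart_cod phi x -> \forall y \near x, chart_cod phi y.
Proof. by move=> cx; apply: open_nbhs_nbhs; split => //; exact: chart_open_cod. Qed.

Lemma chart_cod_image phi p : chart_dom phi p -> chart_cod phi (phi p).
Proof. by move=> dp; exists p. Qed.

Lemma chart_inv_dom phi x : chart_cod phi x -> chart_dom phi (chart_inv phi x).
Proof. by move=> [p dp <-]; rewrite chart_mapK. Qed.

Lemma chart_invK phi x : chart_cod phi x -> phi (chart_inv phi x) = x.
Proof. by move=> [p dp <-]; rewrite chart_mapK. Qed.

Lemma chart_continuous_at phi p : chart_dom phi p -> {for p, continuous phi}.
Proof.
move=> dp; have := @chart_map_continuous _ _ _ phi.
rewrite continuous_open_subspace; last exact: chart_open_dom.
by apply; rewrite inE.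
Qed.

Lemma chart_inv_continuous_at phi x :
  chart_cod phi x -> {for x, continuous (chart_inv phi)}.
Proof.
move=> cx; have := @chart_inv_continuous _ _ _ phi.
rewrite continuous_open_subspace; last exact: chart_open_cod.
by apply; rewrite inE.
Qed.

Lemma near_chart phi p (P : M -> Prop) : chart_dom phi p ->
  (\forall q \near p, P q) -> \forall y \near phi p, P (chart_inv phi y).
Proof.
move=> dp nP; have := chart_inv_continuous_at (chart_cod_image dp).
by move=> /(_ P); rewrite chart_mapK //; apply.
Qed.

Lemma near_overlap phi psi p : chart_dom phi p -> chart_dom psi p ->
  \forall y \near phi p, overlap phi psi y.
Proof.
move=> dp dp'.
have n1 := near_chart dp (near_chart_dom dp').
move: (near_chart_cod (chart_cod_image dp)) n1; apply: filterS2 => y cy dy.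
exists (chart_inv phi y); last exact: chart_invK.
by split => //; exact: chart_inv_dom.
Qed.

End ChartTopology.

Section SmoothIntoManifold.
Variables (R : realType) (M : topologicalType) (m : nat).
Variable A : set (chart R M m).
Hypothesis smA : smooth_atlas A.
Implicit Types (phi psi : chart R M m) (V W : normedModType R).

Lemma atlas_smooth_charts phi : A phi -> smooth_charts A phi.
Proof. by move=> Ap psi Apsi; split; apply: (proj2 smA). Qed.

(** [smooth_charts] compares charts with those of [A] only, so two charts of the maximal atlas are
    compared through a chart of [A] around [p]. *)
Lemma transition_smooth phi psi p : smooth_charts A phi -> smooth_charts A psi ->
  chart_dom phi p -> chart_dom psi p -> smooth_at (transition phi psi) (phi p).
Proof.
move=> sphi spsi dphi dpsi; have [a Aa da] := (proj1 smA) p.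
have s1 : smooth_at (transition phi a) (phi p).
  exact: smooth_on_near (sphi _ Aa).1 (near_overlap dphi da).
have s2 : smooth_at (transition a psi) (a p).
  exact: smooth_on_near (spsi _ Aa).2 (near_overlap da dpsi).
have tp : transition phi a (phi p) = a p by rewrite /transition chart_mapK.
have s3 : smooth_at (fun y => transition a psi (transition phi a y)) (phi p).
  by apply: smooth_at_comp => //; rewrite tp.
apply: smooth_at_ext s3.
by move: (near_chart dphi (near_chart_dom da)); apply: filterS => y dy;
   rewrite /transition chart_mapK.
Qed.

(** Continuity is stated apart because the expression in the chart [a] is meaningful only while [f]
    stays in its domain. *)
Definition msmooth V (f : V -> M) (x : V) : Prop :=
  {for x, continuous f} /\
  exists2 a, smooth_charts A a /\ chart_dom a (f x) & smooth_at (fun y => a (f y)) x.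

Lemma msmooth_chart V (f : V -> M) x psi : msmooth f x -> smooth_charts A psi ->
  chart_dom psi (f x) -> smooth_at (fun y => psi (f y)) x.
Proof.
move=> [cf [a [sa da] sf]] sp dp.
have s3 : smooth_at (fun y => transition a psi (a (f y))) x.
  by apply: smooth_at_comp => //; exact: transition_smooth.
apply: smooth_at_ext s3.
have n1 : \forall y \near x, chart_dom a (f y) by exact: cf (near_chart_dom da).
by apply: filterS n1 => y dy; rewrite /transition chart_mapK.
Qed.

Lemma msmooth_chart_inv phi x : smooth_charts A phi -> chart_cod phi x ->
  msmooth (chart_inv phi) x.
Proof.
move=> sphi cx; split; first exact: chart_inv_continuous_at.
exists phi; first by split => //; exact: chart_inv_dom.
apply: smooth_at_ext (smooth_at_id x).
by apply: filterS (near_chart_cod cx) => y cy; rewrite chart_invK.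
Qed.

Lemma msmooth_cst V (x : V) p : msmooth (fun=> p) x.
Proof.
split; first exact: cvg_cst.
have [a Aa da] := (proj1 smA) p; exists a; last exact: smooth_at_cst.
by split => //; exact: atlas_smooth_charts.
Qed.

Lemma msmooth_comp V W {fW : fin_dim W} (g : V -> W) (f : W -> M) x :
  smooth_at g x -> msmooth f (g x) -> msmooth (fun y => f (g y)) x.
Proof.
move=> sg [cf [a [sa da] sf]]; split.
  by apply: (@continuous_comp _ _ _ g f) => //; exact: smooth_at_continuous.
exists a => //; exact: (smooth_at_comp (f := fun y => a (f y))).
Qed.

End SmoothIntoManifold.

Section SmoothIntoGroup.
Variables (R : realType) (m : nat) (G : topologicalGroupType) (A : set (chart R G m)).
Hypothesis LA : lie_group A.
Implicit Types V : normedModType R.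

Lemma mulg_continuous_at2 (S T : topologicalType) (f : S -> G) (g : T -> G) x y :
  {for x, continuous f} -> {for y, continuous g} ->
  {for (x, y), continuous (fun z : S * T => (f z.1 * g z.2)%g)}.
Proof.
move=> cf cg.
have c1 : {for (x, y), continuous (fun z : S * T => f z.1)}.
  by apply: (@continuous_comp _ _ _ fst f) => //; exact: cvg_fst.
have c2 : {for (x, y), continuous (fun z : S * T => g z.2)}.
  by apply: (@continuous_comp _ _ _ snd g) => //; exact: cvg_snd.
apply: (@continuous_comp _ _ _ (fun z : S * T => (f z.1, g z.2)) (fun z => (z.1 * z.2)%g)).
  exact: (cvg_pair c1 c2).
exact: mulg_continuous.
Qed.

Lemma msmooth_mul V (f g : V -> G) x : msmooth A f x -> msmooth A g x ->
  msmooth A (fun y => f y * g y)%g x.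
Proof.
move=> sf sg; have [cf _] := sf; have [cg _] := sg.
have smA := lie_atlas LA.
split.
  apply: (@continuous_comp _ _ _ (fun y => (f y, g y)) (fun z => (z.1 * z.2)%g)).
    exact: cvg_pair.
  exact: mulg_continuous.
have [a Aa da] := (proj1 smA) (f x); have [b Ab db] := (proj1 smA) (g x).
have [c Ac dc] := (proj1 smA) (f x * g x)%g.
have as_ := atlas_smooth_charts smA.
exists c; first by split => //; exact: as_.
have sa := msmooth_chart smA sf (as_ _ Aa) da.
have sb := msmooth_chart smA sg (as_ _ Ab) db.
have cp : {for (a (f x), b (g x)), continuous
    (fun z : 'rV[R]_m * 'rV[R]_m => (chart_inv a z.1 * chart_inv b z.2)%g)}.
  apply: mulg_continuous_at2.
    exact: chart_inv_continuous_at (chart_cod_image da).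
  exact: chart_inv_continuous_at (chart_cod_image db).
have sM : smooth_at (fun z : 'rV[R]_m * 'rV[R]_m =>
    c (chart_inv a z.1 * chart_inv b z.2)%g) (a (f x), b (g x)).
  apply: smooth_on_near (lie_mul_smooth LA Aa Ab Ac) _.
  have n1 : \forall z \near (a (f x), b (g x)), chart_cod a z.1.
    exact: (@cvg_fst _ _ _ _ _) (near_chart_cod (chart_cod_image da)).
  have n2 : \forall z \near (a (f x), b (g x)), chart_cod b z.2.
    exact: (@cvg_snd _ _ _ _ _) (near_chart_cod (chart_cod_image db)).
  have n3 : \forall z \near (a (f x), b (g x)),
      chart_dom c (chart_inv a z.1 * chart_inv b z.2)%g.
    by apply: cp => /=; rewrite !chart_mapK //; exact: near_chart_dom.
  apply: filterS3 n1 n2 n3 => -[z w] /= cz cw dz.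
  exists (chart_inv a z, chart_inv b w) => /=; last by rewrite !chart_invK.
  by split => //; exact: chart_inv_dom.
have s3 : smooth_at (fun y => c (chart_inv a (a (f y)) * chart_inv b (b (g y)))%g) x.
  exact: (smooth_at_comp (g := fun y => (a (f y), b (g y))) (smooth_at_pair sa sb) sM).
apply: smooth_at_ext s3.
have n1 : \forall y \near x, chart_dom a (f y) by exact: cf (near_chart_dom da).
have n2 : \forall y \near x, chart_dom b (g y) by exact: cg (near_chart_dom db).
by apply: filterS2 n1 n2 => y dy dy'; rewrite /= !chart_mapK.
Qed.

Lemma msmooth_inv V (f : V -> G) x : msmooth A f x -> msmooth A (fun y => (f y)^-1)%g x.
Proof.
move=> sf; have [cf _] := sf.
have smA := lie_atlas LA.
split.
  by apply: (@continuous_comp _ _ _ f (fun z => z^-1%g)) => //; exact: invg_continuous.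
have [a Aa da] := (proj1 smA) (f x); have [c Ac dc] := (proj1 smA) (f x)^-1%g.
have as_ := atlas_smooth_charts smA.
exists c; first by split => //; exact: as_.
have sa := msmooth_chart smA sf (as_ _ Aa) da.
have cp : {for a (f x), continuous (fun z => (chart_inv a z)^-1%g)}.
  apply: (@continuous_comp _ _ _ (chart_inv a) (fun z => z^-1%g)); last exact: invg_continuous.
  exact: chart_inv_continuous_at (chart_cod_image da).
have sI : smooth_at (fun z => c (chart_inv a z)^-1%g) (a (f x)).
  apply: smooth_on_near (lie_inv_smooth LA Aa Ac) _.
  have n1 := near_chart_cod (chart_cod_image da).
  have n3 : \forall z \near a (f x), chart_dom c (chart_inv a z)^-1%g.
    by apply: cp => /=; rewrite !chart_mapK //; exact: near_chart_dom.
  apply: filterS2 n1 n3 => z cz dz.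
  exists (chart_inv a z) => /=; last by rewrite !chart_invK.
  by split => //; exact: chart_inv_dom.
have s3 : smooth_at (fun y => c (chart_inv a (a (f y)))^-1%g) x.
  exact: (smooth_at_comp (g := fun y => a (f y)) sa sI).
apply: smooth_at_ext s3.
have n1 : \forall y \near x, chart_dom a (f y) by exact: cf (near_chart_dom da).
by apply: filterS n1 => y dy; rewrite /= !chart_mapK.
Qed.

End SmoothIntoGroup.

(** * Holomorphic germs *)

Section Holomorphic.
Variables (R : realType) (n : nat).
Local Notation C := R[i].
Local Notation E := 'rV[R]_(n + n).

Definition holo_at (f : E -> E) (x : E) : Prop :=
  smooth_at f x /\ \forall y \near x, forall v, 'D_(mulJ v) f y = mulJ ('D_v f y).

Lemma holomorphic_on_near (U : set E) (f : E -> E) x :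
  holomorphic_on U f -> (\forall y \near x, U y) -> holo_at f x.
Proof.
move=> [sf Jf] nU; split; first exact: smooth_on_near sf nU.
by apply: filterS nU => y Uy v; exact: Jf.
Qed.

(** Vectors are rows, so this is the transpose of the usual complex Jacobian and multiplies on the
    right. *)
Definition cjacobian (f : E -> E) (x : E) : 'M[C]_n :=
  \matrix_k cvec ('D_(cbasis R k) f x).

Lemma cvec_derive_holo (f : E -> E) x v : holo_at f x ->
  cvec ('D_v f x) = cvec v *m cjacobian f x.
Proof.
move=> [sf /nbhs_singleton Jf].
have df : differentiable f x by exact: smooth_at_differentiable.
apply/rowP => l; rewrite [RHS]mxE.
rewrite (@clinear_cbasis _ _ (fun u => cvec ('D_u f x) 0 l)).
- by apply: eq_bigr => k _; rewrite [cjacobian _ _ _ _]mxE.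
- by move=> c u w; rewrite (deriveDv (c *: u) w df) (deriveZv c u df);
     move: ('D_u f x) ('D_w f x) => a b; rewrite cvec_linear !mxE.
- by move=> u; rewrite Jf cvec_mulJ mxE.
Qed.

Lemma frame_mx_holo (f : E -> E) x (v : 'I_n -> E) : holo_at f x ->
  frame_mx (fun j => 'D_(v j) f x) = frame_mx v *m cjacobian f x.
Proof.
move=> hf; apply/row_matrixP => j; rewrite row_mul !rowK.
exact: cvec_derive_holo.
Qed.

Lemma mulJ_smooth (x : E) : smooth_at (@mulJ R n) x.
Proof.
apply: smooth_at_rV => i; rewrite /mulJ.
have [k ->|k ->] := split_ordP i.
  have -> : (fun y : E => row_mx (- rsubmx y) (lsubmx y) 0 (lshift n k) : R^o) =
      (fun y => - (y 0 (rshift n k))).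
    by apply/funext => y; rewrite row_mxEl !mxE.
  by apply: smooth_at_opp; apply: (smooth_at_coord (f := fun y => y)); exact: smooth_at_id.
have -> : (fun y : E => row_mx (- rsubmx y) (lsubmx y) 0 (rshift n k) : R^o) =
    (fun y => y 0 (lshift n k)).
  by apply/funext => y; rewrite row_mxEr !mxE.
by apply: (smooth_at_coord (f := fun y => y)); exact: smooth_at_id.
Qed.

Lemma mulJ_linear : linear (@mulJ R n).
Proof.
move=> c u v; apply/rowP => i; rewrite [RHS]mxE [X in _ = X + _]mxE /mulJ.
have [k ->|k ->] := split_ordP i; last by rewrite !row_mxEr !mxE.
by rewrite !row_mxEl !mxE opprD mulrN.
Qed.

Lemma derive_mulJ (V : normedModType R) (f : V -> E) x v : smooth_at f x ->
  'D_v (fun y => mulJ (f y)) x = mulJ ('D_v f x).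
Proof.
move=> sf.
pose Lm := GRing.isLinear.Build _ _ _ _ _ mulJ_linear.
pose L : {linear E -> E} := HB.pack (@mulJ R n) Lm.
have cL : continuous L by move=> y; exact: smooth_at_continuous (mulJ_smooth y).
by have [] := is_derive_linear (L := L) cL (smooth_at_derivable (v := v) sf).
Qed.

Definition cholo_at (h : E -> C) (x : E) : Prop :=
  csmooth_at h x /\ forall v, cderive (mulJ v) h x = 'i%C * cderive v h x.

Lemma cholo_at_on (U : set E) (h : E -> C) :
  (forall x, U x -> cholo_at h x) -> cholomorphic_on U h.
Proof.
move=> H; split; first by apply: csmooth_at_on => x /H [].
by move=> x v /H [].
Qed.

Lemma cholo_at_cst a x : cholo_at (fun=> a) x.
Proof. by split; [exact: csmooth_at_cst|move=> v; rewrite !cderive_cst mulr0]. Qed.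

Lemma cholo_atD f g x : cholo_at f x -> cholo_at g x -> cholo_at (fun y => f y + g y) x.
Proof.
move=> [sf Jf] [sg Jg]; split; first exact: csmooth_atD.
by move=> v; rewrite !cderiveD // Jf Jg mulrDr.
Qed.

Lemma cholo_atM f g x : cholo_at f x -> cholo_at g x -> cholo_at (fun y => f y * g y) x.
Proof.
move=> [sf Jf] [sg Jg]; split; first exact: csmooth_atM.
by move=> v; rewrite !cderiveM // Jf Jg mulrDr !(mulrCA 'i%C).
Qed.

Lemma cholo_at_inv f x : f x != 0 -> cholo_at f x -> cholo_at (fun y => (f y)^-1) x.
Proof.
move=> fx0 [sf Jf]; split; first exact: csmooth_at_inv.
by move=> v; rewrite !cderive_inv // Jf mulrCA.
Qed.

Lemma cholo_at_sum (I : Type) (r : seq I) (F : I -> E -> C) x :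
  (forall i, cholo_at (F i) x) -> cholo_at (fun y => \sum_(i <- r) F i y) x.
Proof.
move=> H; elim: r => [|i r IH].
  by under eq_fun do rewrite big_nil; exact: cholo_at_cst.
by under eq_fun do rewrite big_cons; exact: cholo_atD.
Qed.

Lemma cholo_at_prod (I : Type) (r : seq I) (F : I -> E -> C) x :
  (forall i, cholo_at (F i) x) -> cholo_at (fun y => \prod_(i <- r) F i y) x.
Proof.
move=> H; elim: r => [|i r IH].
  by under eq_fun do rewrite big_nil; exact: cholo_at_cst.
by under eq_fun do rewrite big_cons; exact: cholo_atM.
Qed.

Lemma cholo_at_det k (M : E -> 'M[C]_k) x :
  (forall i j, cholo_at (fun y => M y i j) x) -> cholo_at (fun y => \det (M y)) x.
Proof.
move=> H; apply: cholo_at_sum => s; apply: cholo_atM; first exact: cholo_at_cst.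
by apply: cholo_at_prod => i; exact: H.
Qed.

Lemma cholo_at_cvec (f : E -> E) x k : smooth_at f x ->
  (forall v, 'D_(mulJ v) f x = mulJ ('D_v f x)) ->
  cholo_at (fun y => cvec (f y) 0 k) x.
Proof.
move=> sf Jf; split; first exact: csmooth_at_cvec.
by move=> v; rewrite !cderive_cvec // Jf cvec_mulJ mxE.
Qed.

(** The complex linear extension of [cvec] to the complexified tangent space. Its kernel is the
    space of antiholomorphic vectors. *)
Definition cproj : 'M[C]_(n + n, n) := \matrix_i cvec (delta_mx 0 i).

Lemma cvec_cproj (v : E) : cvec v = map_mx (real_complex R) v *m cproj.
Proof.
apply/rowP => k; rewrite !mxE.
rewrite (eq_bigr (fun i => (v 0 i)%:C%C * cvec (delta_mx 0 i) 0 k)) => [|i _]; last by rewrite !mxE.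
have phi0 : cvec (0 : E) = 0.
  by apply/rowP => j; rewrite !mxE.
have phiS (I : Type) (r : seq I) (c : I -> R) (u : I -> E) :
    cvec (\sum_(i <- r) c i *: u i) = \sum_(i <- r) (c i)%:C%C *: cvec (u i).
  by elim: r => [|i r IH]; rewrite ?big_nil // !big_cons cvec_linear IH.
transitivity (cvec v 0 k); first by rewrite mxE.
rewrite [in LHS](row_sum_delta v) phiS summxE.
by apply: eq_bigr => i _; rewrite mxE.
Qed.

Lemma cproj_full : row_full cproj.
Proof.
apply/row_fullP; exists (row_mx 1%:M 0).
rewrite -[cproj]vsubmxK mul_row_col mul1mx mul0mx addr0.
apply/row_matrixP => k; apply/rowP => j; rewrite !mxE !eqxx /=.
by rewrite (inj_eq (@lshift_inj _ _)) eq_rlshift [j == k]eq_sym; case: eqP.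
Qed.

(** The complexification of a real linear map, acting on rows; composition becomes the product in
    the opposite order. *)
Definition real_mx (L : E -> E) : 'M[C]_(n + n) :=
  \matrix_i map_mx (real_complex R) (L (delta_mx 0 i)).

Lemma real_mxE (L : E -> E) u : linear L ->
  map_mx (real_complex R) (L u) = map_mx (real_complex R) u *m real_mx L.
Proof.
move=> lL.
have L0 : L 0 = 0 by have := lL (-1) 0 0; rewrite scaler0 addr0 scaleN1r addNr.
have LS (I : Type) (r : seq I) (c : I -> R) (w : I -> E) :
    L (\sum_(i <- r) c i *: w i) = \sum_(i <- r) c i *: L (w i).
  by elim: r => [|i r IH]; rewrite ?big_nil // !big_cons lL IH.
rewrite [in LHS](row_sum_delta u) LS; apply/rowP => j; rewrite mxE summxE rmorph_sum mxE.
by apply: eq_bigr => i _; rewrite !mxE rmorphM.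
Qed.

Lemma real_mx_comp (L L' : E -> E) : linear L ->
  real_mx (fun u => L (L' u)) = real_mx L' *m real_mx L.
Proof.
move=> lL; apply/row_matrixP => i; rewrite row_mul !rowK.
exact: real_mxE.
Qed.

End Holomorphic.

(** * Right-invariant vector fields *)

Section InvariantComplexStructure.
Variables (R : realType) (n : nat) (G : topologicalGroupType).
Variables (A J : set (chart R G (n + n))).
Hypothesis (LA : lie_group A) (CJ : complex_structure A J) (LJ : left_invariant J).
Variable (psi0 : chart R G (n + n)).
Hypothesis (J0 : J psi0) (d0 : chart_dom psi0 1%g).
Local Notation C := R[i].
Local Notation E := 'rV[R]_(n + n).
Implicit Types (phi psi : chart R G (n + n)) (p : G).

Local Notation smA := (lie_atlas LA).
Local Notation x0 := (psi0 1%g).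

Lemma J_smooth psi : J psi -> smooth_charts A psi.
Proof. exact: cplx_smooth CJ psi. Qed.

Lemma chart_cod_unit : chart_cod psi0 x0. Proof. exact: chart_cod_image. Qed.

Lemma chart_inv_unit : chart_inv psi0 x0 = 1%g. Proof. exact: chart_mapK. Qed.

Lemma holo_transition phi psi p : J phi -> J psi -> chart_dom phi p -> chart_dom psi p ->
  holo_at (transition phi psi) (phi p).
Proof.
move=> Jphi Jpsi dphi dpsi.
exact: holomorphic_on_near (cplx_transition CJ Jphi Jpsi) (near_overlap dphi dpsi).
Qed.

Lemma holo_left_translation g phi psi p : J phi -> J psi -> chart_dom phi p ->
  chart_dom psi (g * p)%g -> holo_at (fun x => psi (g * chart_inv phi x)%g) (phi p).
Proof.
move=> Jphi Jpsi dphi dpsi; apply: holomorphic_on_near (LJ g Jphi Jpsi) _.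
have n1 : \forall q \near p, chart_dom psi (g * q)%g.
  have cg : {for p, continuous (fun q => g * q)%g}.
    by apply: (@mulg_continuous2 G G (fun=> g) id) => y; [exact: cvg_cst|exact: cvg_id].
  exact: cg (near_chart_dom dpsi).
move: (near_chart_cod (chart_cod_image dphi)) (near_chart dphi n1).
apply: filterS2 => y cy dy; exists (chart_inv phi y); last exact: chart_invK.
by split => //; exact: chart_inv_dom.
Qed.

(* [psi (exp(z) * p)] with the chart [psi0] in the role of [exp]; its partial
   derivatives in [z] at the unit are the right-invariant vector fields. *)
Definition prod_chart psi (z : E * E) : E :=
  psi (chart_inv psi0 z.1 * chart_inv psi z.2)%g.

Definition right_field psi (u x : E) : E :=
  'D_u (fun z => prod_chart psi (z, x)) x0.

Lemma prod_chart_smooth psi x : J psi -> chart_cod psi x ->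
  smooth_at (prod_chart psi) (x0, x).
Proof.
move=> Jpsi cx.
have s1 : msmooth A (fun z : E * E => chart_inv psi0 z.1) (x0, x).
  apply: (msmooth_comp (g := fst)); last exact: (msmooth_chart_inv (J_smooth J0) chart_cod_unit).
  exact: smooth_at_fst.
have s2 : msmooth A (fun z : E * E => chart_inv psi z.2) (x0, x).
  apply: (msmooth_comp (g := snd)); last exact: (msmooth_chart_inv (J_smooth Jpsi)).
  exact: smooth_at_snd.
apply: (msmooth_chart smA (msmooth_mul LA s1 s2) (J_smooth Jpsi)).
by rewrite /= chart_inv_unit mul1g; exact: chart_inv_dom.
Qed.

Lemma right_fieldE psi u : right_field psi u = fun x => 'D_(u, 0) (prod_chart psi) (x0, x).
Proof. by apply/funext => x; exact: derive_partial1. Qed.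

Lemma smooth_pair_cst (x : E) : smooth_at (fun y : E => (x0, y)) x.
Proof. by apply: smooth_at_pair; [exact: smooth_at_cst|exact: smooth_at_id]. Qed.

Lemma right_field_smooth psi u x : J psi -> chart_cod psi x ->
  smooth_at (right_field psi u) x.
Proof.
move=> Jpsi cx; rewrite right_fieldE.
apply: (smooth_at_comp (g := fun y => (x0, y)) (f := 'D_(u, 0) (prod_chart psi))).
  exact: smooth_pair_cst.
by apply: smooth_at_derive; exact: prod_chart_smooth.
Qed.

(* Left translations are holomorphic, so [prod_chart psi] is holomorphic in its
   second argument, and this survives differentiation in the first one. *)
Lemma right_field_holo psi u x v : J psi -> chart_cod psi x ->
  'D_(mulJ v) (right_field psi u) x = mulJ ('D_v (right_field psi u) x).
Proof.
move=> Jpsi cx; have sP := prod_chart_smooth Jpsi cx.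
(* By symmetry of second derivatives, the derivative of the field along [w] is the derivative in the
   first argument of the partial derivative along [w] in the second. *)
have D w : 'D_w (right_field psi u) x = 'D_(u, 0) ('D_(0, w) (prod_chart psi)) (x0, x).
  rewrite right_fieldE.
  exact: derive_partial_sym.
rewrite D [in RHS]D.
have s2 : smooth_at ('D_(0, v) (prod_chart psi)) (x0, x) by exact: smooth_at_derive.
rewrite -(derive_mulJ (u, 0) s2); apply: near_eq_derive.
have n1 : \forall z \near (x0, x), chart_cod psi0 z.1.
  exact: (@cvg_fst _ _ _ _ _) (near_chart_cod chart_cod_unit).
have n2 : \forall z \near (x0, x), chart_cod psi z.2.
  exact: (@cvg_snd _ _ _ _ _) (near_chart_cod cx).
have n3 : \forall z \near (x0, x), chart_dom psi (chart_inv psi0 z.1 * chart_inv psi z.2)%g.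
  have := mulg_continuous_at2 (chart_inv_continuous_at chart_cod_unit) (chart_inv_continuous_at cx).
  apply; rewrite /= chart_inv_unit mul1g; apply: near_chart_dom; exact: chart_inv_dom.
apply: filterS3 n1 n2 n3 => -[z y] /= cz cy dzy.
(* The partial map in the second argument is left translation by [chart_inv psi0 z]. Its holomorphy
   is used at all [(z, y)] near [(x0, x)], since the identity is about to be differentiated in
   [z]. *)
have hL := holo_left_translation Jpsi Jpsi (chart_inv_dom cy) dzy.
rewrite chart_invK // in hL.
have [_ /nbhs_singleton/(_ v)] := hL.
by rewrite -(derive_partial2 (prod_chart psi) _ z y) -(derive_partial2 (prod_chart psi) _ z y).
Qed.

(** Near the unit, [prod_chart psi] is the transition map after [prod_chart phi]; by the chain rule
    the local expressions define one vector field on [G]. *)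
Lemma right_field_transition phi psi p u : J phi -> J psi ->
  chart_dom phi p -> chart_dom psi p ->
  right_field psi u (psi p) = 'D_(right_field phi u (phi p)) (transition phi psi) (phi p).
Proof.
move=> Jphi Jpsi dphi dpsi.
have cphi := chart_cod_image dphi.
have sphi : smooth_at (fun z : E => prod_chart phi (z, phi p)) x0.
  apply: (smooth_at_comp (g := fun z => (z, phi p)) (f := prod_chart phi)).
    by apply: smooth_at_pair; [exact: smooth_at_id|exact: smooth_at_cst].
  exact: prod_chart_smooth.
have e0 : prod_chart phi (x0, phi p) = phi p.
  by rewrite /prod_chart /= chart_inv_unit mul1g chart_mapK.
have dT : differentiable (transition phi psi) (prod_chart phi (x0, phi p)).
  by rewrite e0; apply: smooth_at_differentiable; exact: (holo_transition Jphi Jpsi dphi dpsi).1.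
have := derive_comp (v := u) (smooth_at_derivable (v := u) sphi) dT.
rewrite -/(right_field phi u (phi p)) e0 => <-.
apply: near_eq_derive.
have cg : {for x0, continuous (fun z => chart_inv psi0 z * p)%g}.
  apply: (@continuous_comp _ _ _ (chart_inv psi0) (fun q => q * p)%g).
    exact: chart_inv_continuous_at chart_cod_unit.
  by apply: (@mulg_continuous2 G G id (fun=> p)) => y; [exact: cvg_id|exact: cvg_cst].
have n1 : \forall z \near x0, chart_dom phi (chart_inv psi0 z * p)%g.
  by apply: cg => /=; rewrite chart_inv_unit mul1g; exact: near_chart_dom.
by apply: filterS n1 => z dz; rewrite /prod_chart /transition /= !chart_mapK.
Qed.

(** * The adjoint action and its relation to right-invariant fields *)

Definition conj_chart p (z : E) : E := psi0 (p^-1 * chart_inv psi0 z * p)%g.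

(** This is Ad(p^-1) in the coordinates of [psi0]. The inverse reverses products, which compensates
    the reversal caused by acting on rows, so that [adjoint_mx] is multiplicative. *)
Definition adjoint p (u : E) : E := 'D_u (conj_chart p) x0.

Lemma conj_msmooth p x : chart_cod psi0 x ->
  msmooth A (fun z => p^-1 * chart_inv psi0 z * p)%g x.
Proof.
move=> cx; apply: (msmooth_mul LA); last exact: (msmooth_cst smA).
apply: (msmooth_mul LA); first exact: (msmooth_cst smA).
exact: (msmooth_chart_inv (J_smooth J0)).
Qed.

Lemma conj1 p : (p^-1 * chart_inv psi0 x0 * p = 1)%g.
Proof. by rewrite chart_inv_unit mulg1 mulVg. Qed.

Lemma conj_chart_smooth p : smooth_at (conj_chart p) x0.
Proof.
apply: (msmooth_chart smA (conj_msmooth p chart_cod_unit) (J_smooth J0)).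
by rewrite conj1.
Qed.

Lemma conj_chart0 p : conj_chart p x0 = x0.
Proof. by rewrite /conj_chart conj1. Qed.

Lemma adjointM p q u : adjoint (p * q)%g u = adjoint q (adjoint p u).
Proof.
have dq : differentiable (conj_chart q) (conj_chart p x0).
  by rewrite conj_chart0; apply: smooth_at_differentiable; exact: conj_chart_smooth.
have := derive_comp (smooth_at_derivable (v := u) (conj_chart_smooth p)) dq.
rewrite conj_chart0 -/(adjoint p u) -/(adjoint q _) => <-.
apply: near_eq_derive.
have [cg _] := conj_msmooth p chart_cod_unit.
have n1 : \forall z \near x0, chart_dom psi0 (p^-1 * chart_inv psi0 z * p)%g.
  by apply: cg => /=; rewrite conj1; exact: near_chart_dom.
apply: filterS n1 => z dz; rewrite /conj_chart /= chart_mapK //.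
by rewrite invgM !mulgA.
Qed.

Lemma adjoint1 u : adjoint 1%g u = u.
Proof.
rewrite -[RHS](derive_id x0 u); apply: near_eq_derive.
apply: filterS (near_chart_cod chart_cod_unit) => z cz.
by rewrite /conj_chart invg1 mul1g mulg1 chart_invK.
Qed.

Lemma adjoint_linear p (c : R) u v : adjoint p (c *: u + v) = c *: adjoint p u + adjoint p v.
Proof.
have df : differentiable (conj_chart p) x0.
  by apply: smooth_at_differentiable; exact: conj_chart_smooth.
by rewrite /adjoint (deriveDv _ _ df) (deriveZv _ _ df).
Qed.

(** The conjugate is jointly smooth in [p] and the conjugated element, so its derivative in the
    latter is continuous in [p]. *)
Lemma adjoint_continuous u i : continuous (fun p => adjoint p u 0 i : R).
Proof.
move=> p.
have [phi Jphi dphi] := cplx_covering CJ p.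
have cphi := chart_cod_image dphi.
pose F (z : E * E) := psi0 ((chart_inv phi z.1)^-1 * chart_inv psi0 z.2 * chart_inv phi z.1)%g.
have sF : smooth_at F (phi p, x0).
  have s1 : msmooth A (fun z : E * E => chart_inv phi z.1) (phi p, x0).
    apply: (msmooth_comp (g := fst)); last exact: (msmooth_chart_inv (J_smooth Jphi)).
    exact: smooth_at_fst.
  have s2 : msmooth A (fun z : E * E => chart_inv psi0 z.2) (phi p, x0).
    apply: (msmooth_comp (g := snd)); last exact: (msmooth_chart_inv (J_smooth J0) chart_cod_unit).
    exact: smooth_at_snd.
  have s3 := msmooth_mul LA (msmooth_mul LA (msmooth_inv LA s1) s2) s1.
  apply: (msmooth_chart smA s3 (J_smooth J0)).
  by rewrite /= chart_mapK // conj1.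
have FE q : chart_dom phi q -> 'D_(0, u) F (phi q, x0) 0 i = adjoint q u 0 i.
  move=> dq; rewrite -derive_partial2 /adjoint.
  by have -> : (fun w => F (phi q, w)) = conj_chart q
    by apply/funext => w; rewrite /F /= chart_mapK.
have cF : {for (phi p, x0), continuous (fun z => 'D_(0, u) F z 0 i : R^o)}.
  by apply: smooth_at_continuous; apply: smooth_at_coord; exact: smooth_at_derive.
have cc : {for p, continuous (fun q => (phi q, x0))}.
  have c1 := chart_continuous_at dphi.
  have c2 : {for p, continuous (fun=> x0)} by exact: cvg_cst.
  exact: (cvg_pair c1 c2).
have ccc := continuous_comp cc cF.
apply: near_eq_continuous ccc.
by apply: filterS (near_chart_dom dphi) => q dq; exact: FE.
Qed.

Definition adjoint_mx p : 'M[C]_(n + n) := real_mx (adjoint p).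

Lemma adjoint_representation : representation [set: G] adjoint_mx.
Proof.
split.
- move=> i j; split.
    have -> : (fun g => complex.Re (adjoint_mx g i j)) = (fun g => adjoint g (delta_mx 0 i) 0 j).
      by apply/funext => g; rewrite !mxE.
    exact: adjoint_continuous.
  have -> : (fun g => complex.Im (adjoint_mx g i j)) = (fun=> 0).
    by apply/funext => g; rewrite !mxE.
  by move=> x; exact: cvg_cst.
- apply/row_matrixP => i; rewrite rowK adjoint1 row1; apply/rowP => j; rewrite !mxE.
  by case: eqP; case: eqP.
- move=> p q _ _; rewrite -(real_mx_comp _ (adjoint_linear q)).
  by congr real_mx; apply/funext => u; exact: adjointM.
Qed.

(** Each row holds the components along the d/dz_k of the (1, 0)-part of a right-invariant field. *)
Definition right_mx psi (x : E) : 'M[C]_(n + n, n) :=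
  \matrix_i cvec (right_field psi (delta_mx 0 i) x).

Lemma right_mx_transition phi psi p : J phi -> J psi ->
  chart_dom phi p -> chart_dom psi p ->
  right_mx psi (psi p) = right_mx phi (phi p) *m cjacobian (transition phi psi) (phi p).
Proof.
move=> Jphi Jpsi dphi dpsi; apply/row_matrixP => i; rewrite row_mul !rowK.
rewrite (right_field_transition _ Jphi Jpsi dphi dpsi).
exact: cvec_derive_holo (holo_transition Jphi Jpsi dphi dpsi).
Qed.

(** Left translation by [p^-1] carries the value at [p] of the right-invariant field of [u] to
    Ad(p^-1) u at the unit. Being holomorphic, it acts on (1, 0)-parts through its complex Jacobian,
    which is [M]. *)
Lemma adjoint_right_mx psi p : J psi -> chart_dom psi p ->
  exists M : 'M[C]_n, adjoint_mx p *m cproj R n = right_mx psi (psi p) *m M.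
Proof.
move=> Jpsi dpsi.
have d1 : chart_dom psi0 (p^-1 * p)%g by rewrite mulVg.
pose L x := psi0 (p^-1 * chart_inv psi x)%g.
have hL : holo_at L (psi p) := holo_left_translation Jpsi J0 dpsi d1.
exists (cjacobian L (psi p)); apply/row_matrixP => i; rewrite !row_mul !rowK.
rewrite -cvec_cproj -(cvec_derive_holo _ hL); congr cvec.
have cpsi := chart_cod_image dpsi.
have spsi : smooth_at (fun z : E => prod_chart psi (z, psi p)) x0.
  apply: (smooth_at_comp (g := fun z => (z, psi p)) (f := prod_chart psi)).
    by apply: smooth_at_pair; [exact: smooth_at_id|exact: smooth_at_cst].
  exact: prod_chart_smooth.
have e0 : prod_chart psi (x0, psi p) = psi p.
  by rewrite /prod_chart /= chart_inv_unit mul1g chart_mapK.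
have dL : differentiable L (prod_chart psi (x0, psi p)).
  by rewrite e0; apply: smooth_at_differentiable; exact: hL.1.
have := derive_comp (smooth_at_derivable (v := delta_mx 0 i) spsi) dL.
rewrite -/(right_field psi _ (psi p)) e0 => <-.
apply: near_eq_derive.
have cg : {for x0, continuous (fun z => chart_inv psi0 z * p)%g}.
  apply: (@continuous_comp _ _ _ (chart_inv psi0) (fun q => q * p)%g).
    exact: chart_inv_continuous_at chart_cod_unit.
  by apply: (@mulg_continuous2 G G id (fun=> p)) => y; [exact: cvg_id|exact: cvg_cst].
have n1 : \forall z \near x0, chart_dom psi (chart_inv psi0 z * p)%g.
  by apply: cg => /=; rewrite chart_inv_unit mul1g; exact: near_chart_dom.
apply: filterS n1 => z dz; rewrite /conj_chart /L /prod_chart /=.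
by rewrite (chart_mapK dpsi) (chart_mapK dz) mulgA.
Qed.

End InvariantComplexStructure.

(** * The canonical form *)

Lemma cholo_at_ext (R : realType) (n : nat) (f g : 'rV[R]_(n + n) -> R[i]) x :
  {near x, f =1 g} -> cholo_at f x -> cholo_at g x.
Proof.
move=> fg [sf Jf]; split; first exact: csmooth_at_ext fg sf.
by move=> v; rewrite -!(cderive_ext _ fg).
Qed.

(** The complex scalar [c], applied after [cvec], lets one statement give both real multilinearity
    and homogeneity under [mulJ]. *)
Lemma det_frame_mx_linear (R : realType) (n : nat) (u : 'I_n -> 'rV[R]_(n + n)) i (c : R[i]) a b z :
  cvec z = c *: cvec a + cvec b ->
  \det (frame_mx (upd u i z)) =
  c * \det (frame_mx (upd u i a)) + \det (frame_mx (upd u i b)).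
Proof.
move=> zE; rewrite -[X in _ + X]mul1r; apply: (@determinant_multilinear _ _ _ _ _ i).
- by rewrite !rowK /upd eqxx zE scale1r.
- by apply/row_matrixP => k; rewrite !row_rowsub !rowK /upd eq_sym (negPf (neq_lift i k)).
- by apply/row_matrixP => k; rewrite !row_rowsub !rowK /upd eq_sym (negPf (neq_lift i k)).
Qed.

Lemma det_frame_mx_alternating (R : realType) (n m : nat) (k : R[i])
    (D : 'rV[R]_m -> 'rV[R]_(n + n)) : linear D ->
  alternating_multilinear (fun v : 'I_n -> 'rV[R]_m => k * \det (frame_mx (fun j => D (v j)))).
Proof.
move=> lD.
have updD (v : 'I_n -> 'rV[R]_m) i z :
    (fun j => D (upd v i z j)) = upd (fun j => D (v j)) i (D z).
  by apply/funext => j; rewrite /upd; case: eqP.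
split=> [v i c a b|v i j ij vij].
  rewrite !updD (@det_frame_mx_linear _ _ _ i c%:C%C (D a) (D b)).
    by rewrite mulrDr mulrCA.
  by rewrite lD cvec_linear.
rewrite (determinant_alternate ij) ?mulr0 // => l.
by rewrite !mxE vij.
Qed.

Lemma exterior_derivative_ext (R : realType) (m k : nat)
    (w w' : 'rV[R]_m -> ('I_k -> 'rV[R]_m) -> R[i]) x v :
  (\forall y \near x, forall u, w y u = w' y u) ->
  exterior_derivative w x v = exterior_derivative w' x v.
Proof.
move=> ww'; apply: eq_bigr => i _; congr (_ * _); apply: cderive_ext.
by apply: filterS ww' => y ->.
Qed.

Section CanonicalForm.
Variables (R : realType) (n : nat) (G : topologicalGroupType).
Variables (A J : set (chart R G (n + n))).
Hypothesis (LA : lie_group A) (CJ : complex_structure A J) (LJ : left_invariant J).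
Variable (psi0 : chart R G (n + n)).
Hypothesis (J0 : J psi0) (d0 : chart_dom psi0 1%g).
Variable (jc : G -> chart R G (n + n)).
Hypothesis (Jjc : forall p, J (jc p)) (djc : forall p, chart_dom (jc p) p).
Local Notation C := R[i].
Local Notation E := 'rV[R]_(n + n).
Variable (Y : 'M[C]_(n, n + n)).
Hypothesis HY : forall p, Y *m adjoint_mx psi0 p *m cproj R n \in unitmx.
Implicit Types (phi psi : chart R G (n + n)) (p : G).
Local Notation smA := (lie_atlas LA).

(** The coefficient, relative to d/dz_1 ... d/dz_n, of the wedge of the right-invariant fields given
    by the rows of [Y]. *)
Definition density psi (x : E) : C := \det (Y *m right_mx psi0 psi x).

(** The invertible matrix of [HY] factors as [Y *m right_mx psi0 psi (psi p)] times a square matrix,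
    so the first factor is invertible. *)
Lemma density_neq0 psi p : J psi -> chart_dom psi p -> density psi (psi p) != 0.
Proof.
move=> Jpsi dpsi.
have [M MP] := adjoint_right_mx LA CJ LJ J0 d0 Jpsi dpsi.
have := HY p; rewrite -mulmxA MP mulmxA unitmx_mul => /andP[+ _].
by rewrite unitmxE unitfE.
Qed.

Lemma density_holo psi x : J psi -> chart_cod psi x -> cholo_at (density psi) x.
Proof.
move=> Jpsi cx; apply: cholo_at_det => i j.
have -> : (fun y => (Y *m right_mx psi0 psi y) i j) =
    (fun y => \sum_k Y i k * cvec (right_field psi0 psi (delta_mx 0 k) y) 0 j).
  by apply/funext => y; rewrite mxE; apply: eq_bigr => k _; rewrite [right_mx _ _ _ _ _]mxE.
apply: cholo_at_sum => k; apply: cholo_atM; first exact: cholo_at_cst.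
apply: cholo_at_cvec => [|v].
  exact: (right_field_smooth LA CJ J0 d0 _ Jpsi cx).
exact: (right_field_holo LA CJ LJ J0 d0 _ _ Jpsi cx).
Qed.

Lemma density_transition phi psi p : J phi -> J psi -> chart_dom phi p -> chart_dom psi p ->
  density psi (psi p) =
  density phi (phi p) * \det (cjacobian (transition phi psi) (phi p)).
Proof.
move=> Jphi Jpsi dphi dpsi.
by rewrite /density (right_mx_transition LA CJ J0 d0 Jphi Jpsi dphi dpsi) mulmxA det_mulmx.
Qed.

(* The section of the canonical bundle dual to the wedge of the holomorphic
   right-invariant vector fields given by the rows of [Y]. *)
Definition canonical_form : form_data R G (n + n) n := fun phi x v =>
  (density (jc (chart_inv phi x)) (jc (chart_inv phi x) (chart_inv phi x)))^-1 *
  \det (frame_mx (fun j => 'D_(v j) (transition phi (jc (chart_inv phi x))) x)).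

Lemma transition_comp phi chi psi p v : smooth_charts A phi -> smooth_charts A chi ->
  smooth_charts A psi -> chart_dom phi p -> chart_dom chi p -> chart_dom psi p ->
  'D_v (transition phi psi) (phi p) =
  'D_('D_v (transition phi chi) (phi p)) (transition chi psi) (chi p).
Proof.
move=> sphi schi spsi dphi dchi dpsi.
have e : transition phi chi (phi p) = chi p by rewrite /transition chart_mapK.
have dT : differentiable (transition chi psi) (transition phi chi (phi p)).
  by rewrite e; apply: smooth_at_differentiable; exact: (transition_smooth smA).
have s1 := transition_smooth smA sphi schi dphi dchi.
rewrite -e -(derive_comp (smooth_at_derivable (v := v) s1) dT).
apply: near_eq_derive.
have n1 := near_chart dphi (near_chart_dom dchi).
by apply: filterS n1 => y dy; rewrite /transition /= chart_mapK.
Qed.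

(** Passing from [psi] to [jc p] multiplies the density and the frame determinant by the same
    Jacobian determinant, which cancels; it is nonzero as a factor of the density in [jc p]. *)
Lemma canonical_form_chart phi psi p v : smooth_charts A phi -> J psi ->
  chart_dom phi p -> chart_dom psi p ->
  canonical_form phi (phi p) v =
  (density psi (psi p))^-1 * \det (frame_mx (fun j => 'D_(v j) (transition phi psi) (phi p))).
Proof.
move=> sphi Jpsi dphi dpsi; rewrite /canonical_form (chart_mapK dphi).
have Jp := Jjc p; have dp := djc p.
have hT := holo_transition CJ Jpsi Jp dpsi dp.
have sJ := J_smooth CJ.
rewrite (_ : frame_mx (fun j => 'D_(v j) (transition phi (jc p)) (phi p)) =
  frame_mx (fun j => 'D_(v j) (transition phi psi) (phi p)) *m
  cjacobian (transition psi (jc p)) (psi p)); last first.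
  rewrite -(frame_mx_holo _ hT); congr frame_mx; apply/funext => j.
  exact: (transition_comp _ sphi (sJ _ Jpsi) (sJ _ Jp) dphi dpsi dp).
have nz := density_neq0 Jp dp.
move: nz; rewrite (density_transition Jpsi Jp dpsi dp) mulf_eq0 negb_or => /andP[nz1 nz2].
rewrite det_mulmx invfM -mulrA; congr (_ * _).
by rewrite mulrCA mulVf // mulr1.
Qed.

(** The chart [jc q] may jump as [q] varies; one fixed [psi] around [p] gives an expression that can
    be differentiated. *)
Lemma canonical_form_near phi psi p : smooth_charts A phi -> J psi ->
  chart_dom phi p -> chart_dom psi p ->
  \forall y \near phi p, forall v, canonical_form phi y v =
  (density psi (transition phi psi y))^-1 *
  \det (frame_mx (fun j => 'D_(v j) (transition phi psi) y)).
Proof.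
move=> sphi Jpsi dphi dpsi; move: (near_overlap dphi dpsi).
apply: filterS => _ [q [dq dq'] <-] v.
by rewrite (canonical_form_chart _ sphi Jpsi dq dq') /transition chart_mapK.
Qed.

Lemma canonical_form_J phi x v : J phi -> chart_cod phi x ->
  canonical_form phi x v = (density phi x)^-1 * \det (frame_mx v).
Proof.
move=> Jphi [p dp <-]; rewrite (canonical_form_chart _ (J_smooth CJ Jphi) Jphi dp dp).
congr (_ * \det (frame_mx _)); apply/funext => j.
rewrite -[RHS](derive_id (phi p) (v j)); apply: near_eq_derive.
by apply: filterS (near_chart_cod (chart_cod_image dp)) => y cy; rewrite /transition chart_invK.
Qed.

Lemma canonical_form_multilinear phi x : smooth_charts A phi -> chart_cod phi x ->
  alternating_multilinear (canonical_form phi x).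
Proof.
move=> sphi [p dp <-].
have sT := transition_smooth smA sphi (J_smooth CJ (Jjc p)) dp (djc p).
have dT : differentiable (transition phi (jc p)) (phi p) by exact: smooth_at_differentiable.
pose D u := 'D_u (transition phi (jc p)) (phi p).
have lD : linear D.
  by move=> c a b; rewrite /D (deriveDv _ _ dT) (deriveZv _ _ dT).
have -> : canonical_form phi (phi p) = fun v =>
    (density (jc p) (jc p p))^-1 * \det (frame_mx (fun j => D (v j))).
  by apply/funext => v; exact: canonical_form_chart.
exact: det_frame_mx_alternating.
Qed.

Lemma csmooth_pullback phi psi p (v : 'I_n -> E) : smooth_charts A phi -> J psi ->
  chart_dom phi p -> chart_dom psi p ->
  csmooth_at (fun y => (density psi (transition phi psi y))^-1 *
    \det (frame_mx (fun j => 'D_(v j) (transition phi psi) y))) (phi p).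
Proof.
move=> sphi Jpsi dphi dpsi.
have sT := transition_smooth smA sphi (J_smooth CJ Jpsi) dphi dpsi.
have e : transition phi psi (phi p) = psi p by rewrite /transition chart_mapK.
apply: csmooth_atM.
  apply: (csmooth_at_comp (g := transition phi psi) (f := fun z => (density psi z)^-1)) => //.
  rewrite e; apply: csmooth_at_inv; first exact: density_neq0.
  exact: (density_holo Jpsi (chart_cod_image dpsi)).1.
apply: csmooth_at_det => i j.
have -> : (fun y => frame_mx (fun j => 'D_(v j) (transition phi psi) y) i j) =
    (fun y => cvec ('D_(v i) (transition phi psi) y) 0 j).
  by apply/funext => y; rewrite mxE.
by apply: csmooth_at_cvec; exact: smooth_at_derive.
Qed.

Lemma canonical_form_differential : differential_form A canonical_form.
Proof.
split.
- exact: canonical_form_multilinear.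
- move=> phi v sphi; apply: csmooth_at_on => _ [p dp <-].
  apply: csmooth_at_ext (csmooth_pullback v sphi (Jjc p) dp (djc p)).
  by apply: filterS (canonical_form_near sphi (Jjc p) dp (djc p)) => y ->.
- move=> phi psi p v sphi spsi dphi dpsi.
  rewrite (canonical_form_chart _ sphi (Jjc p) dphi (djc p)).
  rewrite (canonical_form_chart _ spsi (Jjc p) dpsi (djc p)).
  congr (_ * \det (frame_mx _)); apply/funext => j.
  exact: (transition_comp _ sphi spsi (J_smooth CJ (Jjc p)) dphi dpsi (djc p)).
Qed.

Lemma canonical_form_k0 : type_k0 J canonical_form.
Proof.
move=> phi x v i Jphi cx; rewrite !canonical_form_J // mulrCA; congr (_ * _).
have -> : frame_mx v = frame_mx (upd v i (v i)).
  by congr frame_mx; apply/funext => j; rewrite /upd; case: eqP => [->|].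
(* Homogeneity is read off from linearity with second vector 0, whose determinant has a zero row. *)
rewrite (@det_frame_mx_linear _ _ v i 'i%C (v i) 0).
  rewrite (_ : \det (frame_mx (upd v i 0)) = 0) ?addr0 //.
  rewrite (expand_det_row _ i) big1 // => j _.
  by rewrite mxE /upd eqxx mxE !mxE mul0r.
rewrite cvec_mulJ (_ : cvec (0 : E) = 0) ?addr0 //.
by apply/rowP => k; rewrite !mxE.
Qed.

Lemma canonical_form_holomorphic : holomorphic_form J canonical_form.
Proof.
move=> phi v Jphi; apply: cholo_at_on => x cx.
have H : cholo_at (fun y => (density phi y)^-1 * \det (frame_mx v)) x.
  apply: cholo_atM; last exact: cholo_at_cst.
  apply: cholo_at_inv; last exact: density_holo.
  by case: cx => p dp <-; exact: density_neq0.
apply: cholo_at_ext H; apply: filterS (near_chart_cod cx) => y cy.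
by rewrite canonical_form_J.
Qed.

(** Near each point the form is the pullback, by the change of charts to [jc p], of h dz_1 ... dz_n
    with [h] the inverse of the density, which is holomorphic. *)
Lemma canonical_form_closed : closed_form A canonical_form.
Proof.
move=> phi x v sphi [p dp <-].
have Jp := Jjc p; have dj := djc p.
have sT := transition_smooth smA sphi (J_smooth CJ Jp) dp dj.
have e : transition phi (jc p) (phi p) = jc p p by rewrite /transition chart_mapK.
have [sh hJ] : cholo_at (fun z => (density (jc p) z)^-1) (jc p p).
  by apply: cholo_at_inv; [exact: density_neq0|exact: (density_holo Jp (chart_cod_image dj))].
rewrite -e in sh hJ.
rewrite -[RHS](exterior_derivative_pullback v sT sh hJ).
by apply: exterior_derivative_ext; exact: canonical_form_near.
Qed.

Lemma canonical_form_nonvanishing : nowhere_vanishing A canonical_form.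
Proof.
move=> phi x sphi [p dp <-].
have Jp := Jjc p; have dj := djc p; have sj := J_smooth CJ Jp.
(* The vectors d/dx_j of the holomorphic chart, moved to [phi]: mapped back by the inverse
   transition they have the identity as frame matrix. *)
exists (fun j => 'D_(rvec (delta_mx 0 j)) (transition (jc p) phi) (jc p p)).
rewrite (canonical_form_chart _ sphi Jp dp dj) mulf_neq0 //.
  by rewrite invr_neq0 //; exact: density_neq0.
rewrite (_ : frame_mx _ = 1%:M) ?det1 ?oner_eq0 //.
apply/row_matrixP => j; rewrite rowK row1.
rewrite -(transition_comp _ sj sphi sj dj dp dj) -[RHS]rvecK; congr cvec.
rewrite -[RHS](derive_id (jc p p)); apply: near_eq_derive.
by apply: filterS (near_chart_cod (chart_cod_image dj)) => y cy; rewrite /transition chart_invK.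
Qed.

End CanonicalForm.

Theorem theorem4p6 (R : realType) (n : nat) (G : topologicalGroupType)
    (A J : set (chart R G (n + n))) :
  lie_group A ->
  simply_connected R G ->
  solvable_group G ->
  complex_structure A J ->
  left_invariant J ->
  (exists tau : form_data R G (n + n) n,
     [/\ differential_form A tau, type_k0 J tau, closed_form A tau
       & nowhere_vanishing A tau]) /\
  canonical_bundle_trivial A J.
Proof.
move=> LA [pc _] [k solG] CJ LJ.
have [psi0 J0 d0] := cplx_covering CJ 1%g.
have [jc Hjc] : {jc : G -> chart R G (n + n) & forall p, J (jc p) /\ chart_dom (jc p) p}.
  apply: (@choice _ _ (fun p psi => J psi /\ chart_dom psi p)) => p.
  by have [psi Jpsi dpsi] := cplx_covering CJ p; exists psi.
have Jjc p := (Hjc p).1; have djc p := (Hjc p).2.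
have sG : subgroup [set: G] by [].
(* The complexified adjoint action and the projection along the antiholomorphic vectors are the
   data; one matrix [Y] serves all points of [G]. *)
have [Y HY] := transverse_subspace sG (path_connected_rigid pc) solG
  (adjoint_representation LA CJ J0 d0) (cproj_full R n).
have {}HY p : Y *m adjoint_mx psi0 p *m cproj R n \in unitmx by exact: HY.
have fD := canonical_form_differential LA CJ LJ J0 d0 Jjc djc HY.
have fk := canonical_form_k0 LA CJ LJ J0 d0 Jjc djc HY.
have fn := canonical_form_nonvanishing LA CJ LJ J0 d0 Jjc djc HY.
split; exists (canonical_form psi0 jc Y); split => //.
  exact: (canonical_form_closed LA CJ LJ J0 d0 Jjc djc HY).
exact: (canonical_form_holomorphic LA CJ LJ J0 d0 Jjc djc HY).
Qed.
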